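(* Assume $\mu>0$ and $B\neq 0$, and let $\alpha\ge J(K^* )$. Define $$\zeta_1 = \frac{1}{\sigma_{\min}(Q)}\Big((1+\|C\|^2\|B\|^2)\frac{\alpha}{\mu}+\|C\|^2\|R\|\Big)-1,$$ $$L=2\|C\|^2\Big(\|R\|+\|B\|^2\Big(1+\frac{2\zeta_1}{\|C\|\|B\|}\Big)\frac{\alpha}{\mu}\Big)\frac{\alpha}{\sigma_{\min}(Q)}.$$ Then for any $K\in\mathbb{K}_\alpha$, $\|\nabla^2J(\mathrm{vec}(K))\|\le L$. Consequently, for any $K,K'\in\mathbb{K}_\alpha$ satisfying $K+\delta(K'-K)\in\mathbb{K}_\alpha$ for all $\delta\in[0,1]$, $$J(K')\le J(K)+\mathrm{Tr}\big(\nabla J(K)^\top(K'-K)\big)+\frac{L}{2}\|K'-K\|_F^2.$$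
   Context: Setting: $A\in\mathbb{R}^{n\times n}$, $B\in\mathbb{R}^{n\times m}$, $C\in\mathbb{R}^{d\times n}$ with $C$ of full row rank; $Q\in\mathbb{R}^{n\times n}$ and $R\in\mathbb{R}^{m\times m}$ are symmetric positive definite. The system is $x_{t+1}=Ax_t+Bu_t$, $y_t=Cx_t$, with static output feedback $u_t=-Ky_t$, $K\in\mathbb{R}^{m\times d}$, so that $x_{t+1}=(A-BKC)x_t$. The initial state $x_0$ is drawn from a distribution $\mathcal{D}$ with second-moment matrix $X_0:=\mathbb{E}_{x_0\sim\mathcal{D}}[x_0x_0^\top]\in\mathbb{R}^{n\times n}$, and $\mu:=\sigma_{\min}(X_0)$ is the minimal singular value of $X_0$. The feasible set is $\mathbb{K}=\{K\in\mathbb{R}^{m\times d}:\rho(A-BKC)<1\}$ ($\rho$ = spectral radius), assumed nonempty. For $K\in\mathbb{K}$ the cost is $J(K)=\mathbb{E}_{x_0\sim\mathcal{D}}\big[\sum_{t=0}^\infty x_t^\top(Q+C^\top K^\top RKC)x_t\big]$. Equivalently $J(K)=\mathrm{Tr}(P_KX_0)$, where $P_K$ is the solution of $P_K=Q+C^\top K^\top RKC+(A-BKC)^\top P_K(A-BKC)$. $K^*$ is a global minimizer of $J$ over $\mathbb{K}$, and $\mathbb{K}_\alpha=\{K\in\mathbb{K}:J(K)\le\alpha\}$. $\|\cdot\|$ is the spectral norm, $\|\cdot\|_F$ the Frobenius norm, $\sigma_{\min}$ the minimal singular value. $\nabla J(K)\in\mathbb{R}^{m\times d}$ is the gradient with respect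 to the Frobenius inner product, and $\nabla^2J(\mathrm{vec}(K))\in\mathbb{R}^{md\times md}$ is the Hessian of $J$ regarded as a function of the vectorization $\mathrm{vec}(K)$. *)

(* Defs.v *)
From HB Require Import structures.
From mathcomp Require Import all_boot all_order all_algebra.
From mathcomp Require Import complex.
From mathcomp Require Import all_classical all_reals all_analysis.

Set Implicit Arguments.
Unset Strict Implicit.
Unset Printing Implicit Defensive.

Import Order.TTheory GRing.Theory Num.Theory.
Import numFieldNormedType.Exports.

Local Open Scope classical_set_scope.
Local Open Scope ring_scope.

Section MatrixNotions.
Variable F : realType.

Definition posdefmx n (M : 'M[F]_n) : Prop :=
  M^T = M /\ forall x : 'cV[F]_n, x != 0 -> 0 < (x^T *m M *m x) 0 0.

(* On column vectors this is the Euclidean norm; the canonical norm `|M| of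
   the library is the max norm. *)
Definition frobenius_norm p q (M : 'M[F]_(p, q)) : F :=
  Num.sqrt (\sum_(i < p) \sum_(j < q) M i j ^+ 2).

Definition spectral_norm p q (M : 'M[F]_(p, q)) : F :=
  sup [set frobenius_norm (M *m x)
      | x in [set x : 'cV[F]_q | frobenius_norm x <= 1]].

Definition singular_values n (M : 'M[F]_n) : set F :=
  [set s | 0 <= s /\ eigenvalue (M^T *m M) (s ^+ 2)].

(* For n > 0 the set is finite and nonempty, so the infimum is a minimum. *)
Definition sigma_min n (M : 'M[F]_n) : F := inf (singular_values M).

(* The eigenvalues are those of M as a complex matrix; for n > 0 the supremum
   is a maximum. *)
Definition spectral_radius n (M : 'M[F]_n) : F :=
  sup [set Normc.normc z
      | z in [set z : F[i] | eigenvalue (map_mx (real_complex F) M) z]].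

(* Column-stacking vectorization: mxvec concatenates rows into a row vector,
   hence the transpositions. *)
Definition vec p q (M : 'M[F]_(p, q)) : 'cV[F]_(q * p) := (mxvec M^T)^T.

Definition unvec p q (v : 'cV[F]_(q * p)) : 'M[F]_(p, q) := (vec_mx v^T)^T.

Lemma vecK p q : cancel (@vec p q) (@unvec p q).
Proof. by move=> M; rewrite /unvec /vec trmxK mxvecK trmxK. Qed.

(* Matrix of partial derivatives; where f is differentiable it represents
   the differential via the Frobenius inner product tr(G^T E). *)
Definition gradient p q (f : 'M[F]_(p, q) -> F) (M : 'M[F]_(p, q)) :
    'M[F]_(p, q) :=
  \matrix_(i, j) 'D_(delta_mx i j) f M.

Definition hessian p (f : 'cV[F]_p -> F) (v : 'cV[F]_p) : 'M[F]_p :=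
  \matrix_(i, j) 'D_(delta_mx j 0) (fun w => gradient f w i 0) v.

(* 'D is a total operator; this predicate says that the gradient near v and
   the Hessian at v are genuine. *)
Definition twice_differentiable p (f : 'cV[F]_p -> F) (v : 'cV[F]_p) : Prop :=
  (\forall w \near v, differentiable f w) /\ differentiable (gradient f) v.

End MatrixNotions.

Section OutputFeedback.
Variables (F : realType) (n m d : nat).
Variables (A : 'M[F]_n) (B : 'M[F]_(n, m)) (C : 'M[F]_(d, n)).

(* x_{t+1} = A x_t + B u_t with y_t = C x_t and u_t = - K y_t. *)
Fixpoint trajectory (K : 'M[F]_(m, d)) (x : 'cV[F]_n) (t : nat) : 'cV[F]_n :=
  if t is t'.+1 then
    let xt := trajectory K x t' in
    let yt := C *m xt in
    let ut := - (K *m yt) in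
    A *m xt + B *m ut
  else x.

Definition feasible : set 'M[F]_(m, d) :=
  [set K | spectral_radius (A - B *m K *m C) < 1].

(* The distribution of the initial state is the law of a random vector x0. *)
Variables (disp : measure_display) (T : measurableType disp).
Variables (P : probability T F) (x0 : T -> 'cV[F]_n).

Definition random_vector : Prop :=
  forall i, measurable_fun [set: T] (fun w => x0 w i 0).

Definition finite_second_moments : Prop :=
  forall i j,
    P.-integrable [set: T] (fun w => ((x0 w *m (x0 w)^T) i j)%:E).

Definition second_moment : 'M[F]_n :=
  \matrix_(i, j) fine 'E_P[fun w => (x0 w *m (x0 w)^T) i j].

Variables (Q : 'M[F]_n) (R : 'M[F]_m).

Definition stage_cost (K : 'M[F]_(m, d)) (x : 'cV[F]_n) : F :=
  (x^T *m (Q + C^T *m K^T *m R *m K *m C) *m x) 0 0.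

(* The expected total cost is finite on the feasible set; fine only matters
   (sending +oo to 0) outside of it. *)
Definition cost (K : 'M[F]_(m, d)) : F :=
  fine (\int[P]_w
    (\sum_(0 <= t <oo) (stage_cost K (trajectory K (x0 w) t))%:E))%E.

Definition cost_minimizer (Kstar : 'M[F]_(m, d)) : Prop :=
  feasible Kstar /\ forall K, feasible K -> cost Kstar <= cost K.

Definition sublevel (alpha : F) : set 'M[F]_(m, d) :=
  [set K | feasible K /\ cost K <= alpha].

End OutputFeedback.

(* Main.v *)
Require Import Defs.
From HB Require Import structures.
From mathcomp Require Import all_boot all_order all_algebra.
From mathcomp Require Import complex.
From mathcomp Require Import all_classical all_reals all_analysis.
From mathcomp Require Import ring lra.

Set Implicit Arguments.
Unset Strict Implicit.
Unset Printing Implicit Defensive.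

Import Order.TTheory GRing.Theory Num.Theory.
Import numFieldNormedType.Exports.

Local Open Scope classical_set_scope.
Local Open Scope ring_scope.

(** Fix a stabilizing gain K and put A_K = A - B K C.  The cost is tr (P X0), where
    the value matrix P solves the discrete Lyapunov equation
    P = S + A_K^T P A_K with S = Q + C^T K^T R K C, and by adjointness it is also
    tr (S Sigma), where the state matrix solves
    Sigma = X0 + A_K Sigma A_K^T ([cost_trace], [lyap_adjoint]).  Differentiating
    both Lyapunov equations gives the gradient
    2 (R K C - B^T P A_K) Sigma C^T and the Hessian form
      2 tr ((G C)^T R (E C) Sigma) + 2 tr ((B G C)^T P (B E C) Sigma)
      - 2 tr ((B G C)^T W_E A_K Sigma) - 2 tr ((B E C)^T W_G A_K Sigma),
    where W_E is the derivative of P along E ([cost_hessian_pair]).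

    Two facts bound this form on the sublevel set.  Since X0 dominates mu I and S
    dominates sigma_min(Q) I, the traces of P and Sigma are at most alpha / mu and
    alpha / sigma_min(Q) ([trace_value_le], [trace_state_le]).  And W_E solves a
    Lyapunov equation whose source is, by Young's inequality and the equation of P
    itself, at most zeta Q when E has norm at most 1 ([value_source_le]); monotonicity
    of the Lyapunov operator then encloses W_E between - zeta P and zeta P
    ([value_diff_le]).  Factoring Sigma = Z Z^T, Cauchy-Schwarz for the Frobenius
    product finishes the estimate ([cost_hessian_le]); the descent inequality is
    Taylor's formula along the segment ([second_order_upper_bound]).

    The analysis underneath rests on three points.  A spectral radius below 1 makes
    the powers of A_K vanish, by Cayley-Hamilton over the complex numbers
    ([spectral_radius_power_vanishing]).  Stability in this sense is equivalent to
    the existence of a quadratic Lyapunov function, so it is an open condition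
    ([power_vanishing_near]).  The solution of a Lyapunov equation is a rational
    function of the data by Cramer's formula, so it is differentiable, and its
    derivative is read off the equation ([has_diff_lyap]). *)

(** * Frobenius inner product and quadratic forms *)

Section FrobeniusInnerProduct.
Variable F : realType.

(** The quadratic form at (q, - p) equals p (p r - q ^ 2), which settles p > 0;
    for p = 0 the form is affine along b = 1, so q must vanish. *)
Lemma discriminant_le (p q r : F) :
  (forall a b, 0 <= a ^+ 2 * p + 2 * (a * b * q) + b ^+ 2 * r) -> q ^+ 2 <= p * r.
Proof.
move=> h.
have p0 : 0 <= p by have := h 1 0; nra.
have [pgt0|] := ltP 0 p.
  have := h q (- p).
  have -> : q ^+ 2 * p + 2 * (q * - p * q) + (- p) ^+ 2 * r =
            p * (p * r - q ^+ 2) by ring.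
  by rewrite pmulr_rge0// subr_ge0.
move=> p_le0; have {p0 p_le0} p_eq0 : p = 0 by apply/le_anti/andP.
rewrite p_eq0 mul0r; have [->|q0] := eqVneq q 0; first by rewrite expr0n.
have := h (- (r + 1) / (2 * q)) 1; rewrite p_eq0.
have -> : (- (r + 1) / (2 * q)) ^+ 2 * 0 + 2 * (- (r + 1) / (2 * q) * 1 * q)
   + 1 ^+ 2 * r = -1 by field.
lra.
Qed.

Lemma trmxD (p q : nat) (X Y : 'M[F]_(p, q)) : (X + Y)^T = X^T + Y^T.
Proof. exact: linearD. Qed.

Lemma trmxB (p q : nat) (X Y : 'M[F]_(p, q)) : (X - Y)^T = X^T - Y^T.
Proof. exact: linearB. Qed.

Lemma trmxZ (p q : nat) (a : F) (X : 'M[F]_(p, q)) : (a *: X)^T = a *: X^T.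
Proof. exact: linearZ. Qed.

Lemma mxtraceB (p : nat) (X Y : 'M[F]_p) : \tr (X - Y) = \tr X - \tr Y.
Proof. exact: linearB. Qed.

Lemma mxtr_mulT (p q : nat) (X Y : 'M[F]_(p, q)) :
  \tr (X^T *m Y) = \sum_i \sum_j X i j * Y i j.
Proof.
rewrite /mxtrace exchange_big /=; apply: eq_bigr => j _.
by rewrite mxE; apply: eq_bigr => i _; rewrite mxE.
Qed.

Lemma mxtr_mulT_sym (p q : nat) (X Y : 'M[F]_(p, q)) :
  \tr (X^T *m Y) = \tr (Y^T *m X).
Proof. by rewrite -mxtrace_tr trmx_mul trmxK. Qed.

Lemma fro_sqr (p q : nat) (M : 'M[F]_(p, q)) :
  frobenius_norm M ^+ 2 = \tr (M^T *m M).
Proof.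
rewrite /frobenius_norm sqr_sqrtr ?mxtr_mulT.
  by apply: eq_bigr => i _; apply: eq_bigr => j _; rewrite expr2.
by apply: sumr_ge0 => i _; apply: sumr_ge0 => j _; rewrite sqr_ge0.
Qed.

Lemma fro_ge0 (p q : nat) (M : 'M[F]_(p, q)) : 0 <= frobenius_norm M.
Proof. exact: sqrtr_ge0. Qed.

Lemma mxtr_sqr_ge0 (p q : nat) (M : 'M[F]_(p, q)) : 0 <= \tr (M^T *m M).
Proof. by rewrite -fro_sqr sqr_ge0. Qed.

Lemma fro0 (p q : nat) : frobenius_norm (0 : 'M[F]_(p, q)) = 0.
Proof.
by apply/eqP; rewrite -sqrf_eq0 fro_sqr mulmx0 mxtrace0.
Qed.

Lemma fro_eq0 (p q : nat) (M : 'M[F]_(p, q)) : frobenius_norm M = 0 -> M = 0.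
Proof.
move=> /eqP; rewrite -sqrf_eq0 fro_sqr mxtr_mulT => /eqP h.
apply/matrixP => i j; rewrite mxE.
have h1 : \sum_j M i j * M i j = 0.
  apply: (psumr_eq0P _ h) => // k _.
  by apply: sumr_ge0 => l _; rewrite -expr2 sqr_ge0.
have : M i j * M i j = 0.
  by apply: (psumr_eq0P _ h1) => // k _; rewrite -expr2 sqr_ge0.
by move/eqP; rewrite mulf_eq0 orbb => /eqP.
Qed.

Lemma fro_gt0 n p (X : 'M[F]_(n, p)) : X != 0 -> 0 < frobenius_norm X.
Proof.
move=> X0; rewrite lt_neqAle eq_sym fro_ge0 andbT.
by apply: contra X0 => /eqP/fro_eq0 ->.
Qed.

Lemma fro_tr (p q : nat) (M : 'M[F]_(p, q)) :
  frobenius_norm M^T = frobenius_norm M.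
Proof.
apply/eqP; rewrite -(@eqrXn2 _ 2)// ?fro_ge0// !fro_sqr.
by rewrite trmxK mxtrace_mulC.
Qed.

Lemma froZ (p q : nat) (a : F) (M : 'M[F]_(p, q)) :
  frobenius_norm (a *: M) = `|a| * frobenius_norm M.
Proof.
apply/eqP; rewrite -(@eqrXn2 _ 2)// ?mulr_ge0 ?fro_ge0// exprMn !fro_sqr.
rewrite trmxZ -scalemxAl -scalemxAr scalerA mxtraceZ -expr2.
by rewrite real_normK ?num_real.
Qed.

Lemma mxtr_CauchySchwarz (p q : nat) (X Y : 'M[F]_(p, q)) :
  `|\tr (X^T *m Y)| <= frobenius_norm X * frobenius_norm Y.
Proof.
rewrite -(@ler_pXn2r _ 2)// ?nnegrE ?mulr_ge0 ?fro_ge0//.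
rewrite exprMn !fro_sqr real_normK ?num_real//.
apply: discriminant_le => a b.
have -> : a ^+ 2 * \tr (X^T *m X) + 2 * (a * b * \tr (X^T *m Y)) +
  b ^+ 2 * \tr (Y^T *m Y) = \tr ((a *: X + b *: Y)^T *m (a *: X + b *: Y)).
  rewrite trmxD !trmxZ mulmxDl !mulmxDr -!scalemxAl -!scalemxAr.
  rewrite !mxtraceD !mxtraceZ (mxtr_mulT_sym Y X); ring.
exact: mxtr_sqr_ge0.
Qed.

Lemma fro_sqr_col (p q : nat) (M : 'M[F]_(p, q)) :
  frobenius_norm M ^+ 2 = \sum_j frobenius_norm (col j M) ^+ 2.
Proof.
rewrite fro_sqr mxtr_mulT exchange_big /=; apply: eq_bigr => j _.
rewrite fro_sqr mxtr_mulT; apply: eq_bigr => i _.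
by rewrite big_ord1 mxE.
Qed.

(** The squared Frobenius norm is the sum of the squared norms of the columns,
    so a bound on column vectors passes to matrices of any width. *)
Lemma fro_mulmx_le (p q r : nat) (c : F) (M : 'M[F]_(p, q)) (X : 'M[F]_(q, r)) :
  0 <= c ->
  (forall x : 'cV_q, frobenius_norm (M *m x) <= c * frobenius_norm x) ->
  frobenius_norm (M *m X) <= c * frobenius_norm X.
Proof.
move=> c0 h; rewrite -(@ler_pXn2r _ 2)// ?nnegrE ?mulr_ge0 ?fro_ge0//.
rewrite exprMn !fro_sqr_col mulr_sumr; apply: ler_sum => j _.
by rewrite -exprMn ler_pXn2r ?nnegrE ?mulr_ge0 ?fro_ge0// !colE -mulmxA.
Qed.

(** The bound on a single column is again the columnwise argument, applied to
    the transposes, and reduces to Cauchy-Schwarz for one row. *)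
Lemma fro_mulmx (p q r : nat) (X : 'M[F]_(p, q)) (Y : 'M[F]_(q, r)) :
  frobenius_norm (X *m Y) <= frobenius_norm X * frobenius_norm Y.
Proof.
apply: fro_mulmx_le; first exact: fro_ge0.
move=> y; rewrite -(fro_tr (X *m y)) -(fro_tr X) -(fro_tr y) trmx_mul mulrC.
apply: fro_mulmx_le; first exact: fro_ge0.
move=> x; rewrite -[y in leLHS]trmxK trmxK.
have -> : frobenius_norm (y^T *m x) = `|\tr (y^T *m x)|.
  apply/eqP; rewrite -(@eqrXn2 _ 2)// ?fro_ge0// fro_sqr.
  rewrite real_normK ?num_real// /mxtrace !big_ord1 !mxE big_ord1 !mxE.
  by rewrite expr2.
by rewrite fro_tr; exact: mxtr_CauchySchwarz.
Qed.

(** ** Spectral norm *)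

Lemma spectral_norm_mulmx (p q : nat) (M : 'M[F]_(p, q)) (x : 'cV[F]_q) :
  frobenius_norm (M *m x) <= spectral_norm M * frobenius_norm x.
Proof.
have [x0|x0] := eqVneq (frobenius_norm x) 0.
  by rewrite (fro_eq0 x0) mulmx0 !fro0 mulr0.
have xgt0 : 0 < frobenius_norm x by rewrite lt_neqAle eq_sym x0 fro_ge0.
rewrite -ler_pdivrMr//.
have -> : frobenius_norm (M *m x) / frobenius_norm x =
          frobenius_norm (M *m ((frobenius_norm x)^-1 *: x)).
  rewrite -scalemxAr froZ ger0_norm ?invr_ge0 ?fro_ge0//; exact: mulrC.
apply: ub_le_sup.
  exists (frobenius_norm M * 1) => _ [y /= y1 <-].
  apply: le_trans (fro_mulmx _ _) _; apply: ler_wpM2l => //; exact: fro_ge0.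
exists ((frobenius_norm x)^-1 *: x) => //=.
by rewrite froZ ger0_norm ?invr_ge0 ?fro_ge0// mulVf.
Qed.

Lemma spectral_norm_le (p q : nat) (M : 'M[F]_(p, q)) (c : F) :
  (forall x : 'cV_q, frobenius_norm x <= 1 -> frobenius_norm (M *m x) <= c) ->
  spectral_norm M <= c.
Proof.
move=> h; apply: ge_sup.
  by exists (frobenius_norm (M *m (0 : 'cV_q))), 0 => //=; rewrite fro0 ler01.
by move=> _ [x /= x1 <-]; exact: h.
Qed.

Lemma spectral_norm_ge0 (p q : nat) (M : 'M[F]_(p, q)) : 0 <= spectral_norm M.
Proof.
apply: ub_le_sup; last by exists 0; rewrite /= ?mulmx0 fro0 ?ler01.
exists (frobenius_norm M * 1) => _ [y /= y1 <-].
apply: le_trans (fro_mulmx _ _) _; apply: ler_wpM2l => //; exact: fro_ge0.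
Qed.

Lemma spectral_norm_fro (p q r : nat) (M : 'M[F]_(p, q)) (X : 'M[F]_(q, r)) :
  frobenius_norm (M *m X) <= spectral_norm M * frobenius_norm X.
Proof.
apply: fro_mulmx_le; first exact: spectral_norm_ge0.
exact: spectral_norm_mulmx.
Qed.

Lemma spectral_norm_gt0 (p q : nat) (M : 'M[F]_(p, q)) :
  M != 0 -> 0 < spectral_norm M.
Proof.
move=> M0; rewrite lt_neqAle spectral_norm_ge0 andbT eq_sym.
apply: contra M0 => /eqP M0; apply/eqP/fro_eq0/le_anti; rewrite fro_ge0 andbT.
by have := spectral_norm_fro M (1%:M); rewrite mulmx1 M0 mul0r.
Qed.

End FrobeniusInnerProduct.

(** * Positive semidefinite matrices *)

Section PositiveSemidefinite.
Variable F : realType.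

Definition psdmx n (M : 'M[F]_n) : Prop :=
  forall x : 'cV[F]_n, 0 <= \tr (x^T *m M *m x).

Lemma mxtr_col_form n p (M : 'M[F]_n) (X : 'M[F]_(n, p)) :
  \tr (X^T *m M *m X) = \sum_j \tr ((col j X)^T *m M *m col j X).
Proof.
rewrite /mxtrace; apply: eq_bigr => j _; rewrite big_ord1.
rewrite !mxE; apply: eq_bigr => k _; rewrite !mxE; congr (_ * _).
by apply: eq_bigr => l _; rewrite !mxE.
Qed.

Lemma psdmx_tr n p (M : 'M[F]_n) (X : 'M[F]_(n, p)) :
  psdmx M -> 0 <= \tr (X^T *m M *m X).
Proof. by move=> h; rewrite mxtr_col_form; apply: sumr_ge0 => j _; apply: h. Qed.

Lemma psdmxD n (M N : 'M[F]_n) : psdmx M -> psdmx N -> psdmx (M + N).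
Proof.
by move=> hM hN x; rewrite mulmxDr mulmxDl mxtraceD; exact: addr_ge0.
Qed.

Lemma psdmxZ n (a : F) (M : 'M[F]_n) : 0 <= a -> psdmx M -> psdmx (a *: M).
Proof.
by move=> a0 hM x; rewrite -scalemxAr -scalemxAl mxtraceZ; exact: mulr_ge0.
Qed.

Lemma psdmx_conj n p (M : 'M[F]_n) (X : 'M[F]_(n, p)) :
  psdmx M -> psdmx (X^T *m M *m X).
Proof.
move=> hM x; have := hM (X *m x); rewrite trmx_mul !mulmxA; exact.
Qed.

Lemma form_polar n (M : 'M[F]_n) (x y : 'cV[F]_n) (a b : F) : M^T = M ->
  \tr ((a *: x + b *: y)^T *m M *m (a *: x + b *: y)) =
  a ^+ 2 * \tr (x^T *m M *m x) + 2 * (a * b * \tr (x^T *m M *m y)) +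
  b ^+ 2 * \tr (y^T *m M *m y).
Proof.
move=> sM; have -> : \tr (x^T *m M *m y) = \tr (y^T *m M *m x).
  by rewrite -mxtrace_tr !trmx_mul trmxK sM mulmxA.
rewrite trmxD !trmxZ !mulmxDl !mulmxDr -!scalemxAl -!scalemxAr.
rewrite !mxtraceD !mxtraceZ.
have -> : \tr (x^T *m M *m y) = \tr (y^T *m M *m x).
  by rewrite -mxtrace_tr !trmx_mul trmxK sM mulmxA.
ring.
Qed.

Lemma psdmx_CauchySchwarz n (M : 'M[F]_n) (x y : 'cV[F]_n) : M^T = M ->
  psdmx M ->
  \tr (x^T *m M *m y) ^+ 2 <= \tr (x^T *m M *m x) * \tr (y^T *m M *m y).
Proof.
move=> sM hM; apply: discriminant_le => a b.
by rewrite -form_polar//; exact: hM.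
Qed.

Lemma mxtr_delta n (M : 'M[F]_n) (i j : 'I_n) :
  \tr ((delta_mx i (0 : 'I_1))^T *m M *m delta_mx j (0 : 'I_1)) = M i j.
Proof. by rewrite trmx_delta -mulmxA -colE -rowE /mxtrace big_ord1 !mxE. Qed.

Lemma mxtr_col n (M : 'M[F]_n) (i : 'I_n) (x : 'cV[F]_n) : M^T = M ->
  \tr ((delta_mx i (0 : 'I_1))^T *m M *m x) = \tr ((col i M)^T *m x).
Proof. by move=> sM; rewrite trmx_delta -rowE tr_col sM. Qed.

Lemma mxtr11_mul (X Y : 'M[F]_1) : \tr (X *m Y) = \tr X * \tr Y.
Proof. by rewrite /mxtrace !big_ord1 mxE big_ord1. Qed.

Lemma psdmx_diag0 n (M : 'M[F]_n) (i j : 'I_n) : M^T = M -> psdmx M ->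
  M i i = 0 -> M i j = 0.
Proof.
move=> sM hM Mii.
have := psdmx_CauchySchwarz (delta_mx i 0) (delta_mx j 0) sM hM.
rewrite !mxtr_delta Mii mul0r => h.
by apply/eqP; rewrite -sqrf_eq0; apply/eqP/le_anti; rewrite h sqr_ge0.
Qed.

(** Symmetric Gaussian elimination: with y the column of a nonzero diagonal
    entry M i i, the matrix M - y y^T / M i i is again positive semidefinite
    (Cauchy-Schwarz for the form of M) and has fewer nonzero diagonal entries,
    because a zero diagonal entry forces a zero row. *)
Lemma psdmx_factor n (M : 'M[F]_n) : M^T = M -> psdmx M ->
  exists p (Z : 'M[F]_(n, p)), M = Z *m Z^T.
Proof.
have [k] := ubnP #|[set i | M i i != 0]|%SET.
elim: k M => // k IH M lek sM hM.
have [i Mii|M0] := pickP (fun i => M i i != 0); last first.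
  exists 0%N, 0; rewrite mul0mx; apply/matrixP => i j; rewrite mxE.
  by apply: psdmx_diag0 => //; apply/eqP; have := M0 i => /negbFE.
have Mii_gt0 : 0 < M i i.
  by rewrite lt_neqAle eq_sym Mii -mxtr_delta; exact: hM.
pose y := col i M.
pose N := M - (M i i)^-1 *: (y *m y^T).
have sN : N^T = N by rewrite /N trmxB trmxZ trmx_mul trmxK sM.
have hN : psdmx N.
  move=> x; rewrite /N mulmxBr mulmxBl mxtraceB.
  rewrite -scalemxAr -scalemxAl mxtraceZ subr_ge0 ler_pdivrMl//.
  have := psdmx_CauchySchwarz (delta_mx i 0) x sM hM.
  rewrite mxtr_delta mxtr_col// -/y => /(le_trans _); apply.
  by rewrite [x^T *m _]mulmxA -[_ *m y^T *m x]mulmxA mxtr11_mul (mxtr_mulT_sym x) expr2.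
have [|p [Z NZ]] := IH N _ sN hN.
  rewrite -ltnS; apply: leq_trans lek; rewrite ltnS.
  apply/proper_card/properP; split.
    apply/fintype.subsetP => j; rewrite !inE; apply: contraNN => /eqP Mjj.
    by rewrite !mxE big_ord1 !mxE Mjj (psdmx_diag0 i sM hM Mjj) !mul0r mulr0 subrr.
  by exists i; rewrite !inE// !mxE big_ord1 !mxE negbK; apply/eqP; field.
exists (1 + p)%N, (row_mx ((Num.sqrt (M i i))^-1 *: y) Z).
rewrite tr_row_mx mul_row_col -NZ /N trmxZ -scalemxAl -scalemxAr scalerA.
rewrite -expr2 exprVn sqr_sqrtr ?ltW// addrC subrK.
by [].
Qed.

(** With N = Z Z^T the trace is that of Z^T M Z. *)
Lemma psdmx_tr_mul_ge0 n (M N : 'M[F]_n) : psdmx M -> N^T = N -> psdmx N ->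
  0 <= \tr (M *m N).
Proof.
move=> hM sN hN; have [p [Z ->]] := psdmx_factor sN hN.
by rewrite mulmxA mxtrace_mulC mulmxA; exact: psdmx_tr.
Qed.

Lemma psdmx_le_tr n (M : 'M[F]_n) (x : 'cV[F]_n) : M^T = M -> psdmx M ->
  \tr (x^T *m M *m x) <= \tr M * \tr (x^T *m x).
Proof.
move=> sM hM; have [p [Z ->]] := psdmx_factor sM hM.
have -> : \tr (x^T *m (Z *m Z^T) *m x) = frobenius_norm (Z^T *m x) ^+ 2.
  by rewrite fro_sqr trmx_mul trmxK !mulmxA.
have -> : \tr (Z *m Z^T) = frobenius_norm (Z^T) ^+ 2 by rewrite fro_sqr trmxK.
rewrite -fro_sqr -exprMn ler_pXn2r ?nnegrE ?mulr_ge0 ?fro_ge0//.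
exact: fro_mulmx.
Qed.

(** Polarization turns the bound on the quadratic form into one on the bilinear
    form: 4 y^T W x <= 2 c (|x|^2 + |y|^2).  The choice of y along W x with
    |y| = |x| gives |W x| <= c |x|. *)
Lemma sym_form_bound_norm n p (W : 'M[F]_n) (c : F) (X : 'M[F]_(n, p)) :
  W^T = W -> 0 <= c ->
  (forall x : 'cV_n, `|\tr (x^T *m W *m x)| <= c * \tr (x^T *m x)) ->
  frobenius_norm (W *m X) <= c * frobenius_norm X.
Proof.
move=> sW c0 h; apply: fro_mulmx_le => // x.
have key y : \tr (y^T *m W *m x) * 2 <=
    c * (\tr (x^T *m x) + \tr (y^T *m y)).
  have /ler_normlP[_ h1] := h (1 *: y + 1 *: x).
  have /ler_normlP[h2 _] := h (1 *: y + (-1) *: x).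
  move: h1 h2; rewrite !form_polar//.
  have tr1 z : \tr (z^T *m z) = \tr (z^T *m 1%:M *m z) :> F by rewrite mulmx1.
  rewrite (tr1 _ _ (1 *: y + 1 *: x)) (tr1 _ _ (1 *: y + (-1) *: x)).
  rewrite !form_polar ?trmx1// !mulmx1.
  nra.
have [x0|x0] := eqVneq (frobenius_norm x) 0.
  by rewrite (fro_eq0 x0) mulmx0 !fro0 mulr0.
have xgt0 : 0 < frobenius_norm x by rewrite lt_neqAle eq_sym x0 fro_ge0.
have [y0|y0] := eqVneq (frobenius_norm (W *m x)) 0.
  by rewrite y0 mulr_ge0 ?fro_ge0.
have ygt0 : 0 < frobenius_norm (W *m x) by rewrite lt_neqAle eq_sym y0 fro_ge0.
have := key ((frobenius_norm x / frobenius_norm (W *m x)) *: (W *m x)).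
rewrite -fro_sqr trmxZ trmx_mul sW -!scalemxAl -!scalemxAr !mxtraceZ.
have -> : \tr (x^T *m W *m W *m x) = frobenius_norm (W *m x) ^+ 2.
  by rewrite fro_sqr trmx_mul sW !mulmxA.
have -> : \tr (x^T *m W *m (W *m x)) = frobenius_norm (W *m x) ^+ 2.
  by rewrite fro_sqr trmx_mul sW !mulmxA.
move: (frobenius_norm x) (frobenius_norm (W *m x)) xgt0 ygt0 y0 => a b a0 b0 nb.
have -> : a / b * b ^+ 2 * 2 = 2 * a * b by field.
have -> : c * (a ^+ 2 + a / b * (a / b * b ^+ 2)) = 2 * a * (c * a) by field.
by rewrite ler_pM2l// mulr_gt0.
Qed.

End PositiveSemidefinite.

(** * Differentiation of matrix-valued functions *)

Section MatrixDifferentiation.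
Variables (F : realType) (V : normedModType F).

Lemma differentiable_mxP p q (M : V -> 'M[F]_(p, q)) (v : V) :
  differentiable M v <-> forall i j, differentiable (fun w => M w i j) v.
Proof.
split=> [dM i j|dM].
  exact: (differentiable_comp dM (differentiable_coord (M v) i j)).
have -> : M = \sum_(i < p) \sum_(j < q) (fun w => M w i j *: delta_mx i j).
  apply/funext => w; rewrite [LHS]matrix_sum_delta fct_sumE.
  by apply: eq_bigr => i _; rewrite fct_sumE.
apply: differentiable_sum => i; apply: differentiable_sum => j.
exact: differentiableZl.
Qed.

Lemma differentiable_prod n (f : 'I_n -> V -> F) (v : V) :
  (forall i, differentiable (f i) v) ->
  differentiable (fun w => \prod_(i < n) f i w) v.
Proof.
move=> df; have -> : (fun w => \prod_(i < n) f i w) = \prod_(i < n) f i.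
  by apply/funext => w; rewrite fct_prodE.
elim/big_ind : _ => [|g h dg dh|i _]; last exact: df.
- exact: (differentiable_cst (1 : F)).
- exact: differentiableM.
Qed.

Lemma differentiable_sumT (I : finType) (f : I -> V -> F) (v : V) :
  (forall i, differentiable (f i) v) ->
  differentiable (fun w => \sum_i f i w) v.
Proof.
move=> df; have -> : (fun w => \sum_i f i w) = \sum_i f i.
  by apply/funext => w; rewrite fct_sumE.
elim/big_ind : _ => [|g h dg dh|i _]; last exact: df.
- exact: (differentiable_cst (0 : F)).
- exact: differentiableD.
Qed.

(** The determinant is a polynomial in the entries. *)
Lemma differentiable_det n (M : V -> 'M[F]_n) (v : V) :
  differentiable M v -> differentiable (fun w => \det (M w)) v.
Proof.
move=> /differentiable_mxP dM; apply: differentiable_sumT => s.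
apply: differentiableM; first exact: differentiable_cst.
by apply: differentiable_prod => i.
Qed.

Lemma differentiable_adj n (M : V -> 'M[F]_n) (v : V) :
  differentiable M v -> differentiable (fun w => \adj (M w)) v.
Proof.
move=> /differentiable_mxP dM; apply/differentiable_mxP => i j.
rewrite (_ : (fun w => _) = (fun w => cofactor (M w) j i)); last first.
  by apply/funext => w; rewrite mxE.
apply: differentiableM; first exact: differentiable_cst.
apply: differentiable_det; apply/differentiable_mxP => k l.
by rewrite (_ : (fun w => _) = (fun w => M w (lift j k) (lift i l)));
  [exact: dM | apply/funext => w; rewrite !mxE].
Qed.

(** Differentiability only depends on the germ of the function at the point: the
    cost agrees with its closed formula only near a stabilizing gain. *)
Lemma near_eq_differentiable (W : normedModType F) (f g : V -> W) (v : V) :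
  (\forall w \near v, f w = g w) -> differentiable f v -> differentiable g v.
Proof.
move=> fg df; have fgv := nbhs_singleton fg.
have dg : g \o shift v = cst (g v) + 'd f v +o_ (0 : V) id.
  apply/eqaddoP => e e0.
  have /eqaddoP /(_ e e0) := diff_locally df.
  move: fg; rewrite (near_shift (0 : V)) => fg fo.
  by apply: filterS2 fg fo => z; rewrite !fctE /= subr0 -fgv => <-.
have gx := @diff_unique _ _ _ _ _ _ (diff_continuous df) dg.
by apply/diff_locallyP; rewrite gx; split => //; exact: diff_continuous.
Qed.

(** A directional derivative alone does not compose; pairing it with Frechet
    differentiability makes the rules below closed under each other. *)
Definition has_diff (W : normedModType F) (f : V -> W) (v h : V) (d : W) :=
  differentiable f v /\ 'D_h f v = d.

Section Rules.
Variables (v h : V).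

Lemma differentiable_has_diff (W : normedModType F) (f : V -> W) :
  differentiable f v -> has_diff f v h ('D_h f v).
Proof. by []. Qed.

Lemma has_diff_eq (W : normedModType F) (f : V -> W) d d' :
  has_diff f v h d -> d = d' -> has_diff f v h d'.
Proof. by move=> hf <-. Qed.

Lemma has_diff_near_eq (W : normedModType F) (f g : V -> W) df :
  (\forall w \near v, f w = g w) -> has_diff f v h df -> has_diff g v h df.
Proof.
move=> fg [d1 <-]; split; first exact: near_eq_differentiable d1.
by apply/esym/near_eq_derive.
Qed.

Lemma has_diff_cst (W : normedModType F) (c : W) : has_diff (fun=> c) v h 0.
Proof. by split; [exact: differentiable_cst | exact: derive_cst]. Qed.

Lemma has_diffD (W : normedModType F) (f g : V -> W) df dg :
  has_diff f v h df -> has_diff g v h dg ->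
  has_diff (fun w => f w + g w) v h (df + dg).
Proof.
move=> [f1 <-] [g1 <-]; split; first exact: (differentiableD f1 g1).
by rewrite -deriveD//; exact: diff_derivable.
Qed.

Lemma has_diffB (W : normedModType F) (f g : V -> W) df dg :
  has_diff f v h df -> has_diff g v h dg ->
  has_diff (fun w => f w - g w) v h (df - dg).
Proof.
move=> [f1 <-] [g1 <-]; split; first exact: (differentiableB f1 g1).
by rewrite -deriveB//; exact: diff_derivable.
Qed.

Lemma has_diffZl (W : normedModType F) (f : V -> F) (c : W) df :
  has_diff f v h df -> has_diff (fun w => f w *: c) v h (df *: c).
Proof.
move=> [f1 <-]; have d := differentiableZl c f1.
by split => //; rewrite [LHS]deriveE// diffZl// deriveE.
Qed.

Lemma has_diff_mxE p q (M : V -> 'M[F]_(p, q)) dM :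
  has_diff M v h dM <->
  forall i j, has_diff (fun w => M w i j) v h (dM i j).
Proof.
split=> [[d <-] i j|d].
  split; first by move/differentiable_mxP : d; apply.
  by rewrite derive_mx ?mxE//; exact: diff_derivable.
have d1 : differentiable M v by apply/differentiable_mxP => i j; have [] := d i j.
split => //; rewrite derive_mx; last exact: diff_derivable.
by apply/matrixP => i j; rewrite mxE; have [] := d i j.
Qed.

Lemma has_diffM (f g : V -> F) df dg :
  has_diff f v h df -> has_diff g v h dg ->
  has_diff (fun w => f w * g w) v h (df * g v + f v * dg).
Proof.
move=> [f1 <-] [g1 <-]; split; first exact: (differentiableM f1 g1).
rewrite [LHS](@deriveM _ _ f g)//; [|exact: diff_derivable..].
by rewrite addrC [g v *: _]mulrC.
Qed.

Lemma has_diff_sum (I : finType) (W : normedModType F) (f : I -> V -> W)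
    (df : I -> W) :
  (forall i, has_diff (f i) v h (df i)) ->
  has_diff (fun w => \sum_i f i w) v h (\sum_i df i).
Proof.
move=> d; have : forall r : seq I,
    has_diff (fun w => \sum_(i <- r) f i w) v h (\sum_(i <- r) df i).
  elim=> [|i r IH].
    rewrite big_nil (_ : (fun w => _) = (fun=> 0)); first exact: has_diff_cst.
    by apply/funext => w; rewrite big_nil.
  rewrite big_cons (_ : (fun w => _) = (fun w => f i w + \sum_(j <- r) f j w)).
    exact: has_diffD.
  by apply/funext => w; rewrite big_cons.
exact.
Qed.

(** Continuity of the linear map is automatic in finite dimension: the map is a
    combination of the coordinates with constant vectors as coefficients. *)
Lemma has_diff_linmx p q (W : normedModType F) (l : {linear 'M[F]_(p, q) -> W})
    (f : V -> 'M[F]_(p, q)) df :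
  has_diff f v h df -> has_diff (fun w => l (f w)) v h (l df).
Proof.
move=> /has_diff_mxE hf.
have lE M : l M = \sum_i \sum_j M i j *: l (delta_mx i j).
  rewrite {1}(matrix_sum_delta M) linear_sum; apply: eq_bigr => i _.
  by rewrite linear_sum; apply: eq_bigr => j _; rewrite linearZ.
rewrite lE (_ : (fun w => _) =
  (fun w => \sum_i \sum_j f w i j *: l (delta_mx i j))); last first.
  by apply/funext => w; exact: lE.
by apply: has_diff_sum => i; apply: has_diff_sum => j; exact: has_diffZl.
Qed.

Lemma has_diff_mulmx p q r (X : V -> 'M[F]_(p, q)) (Y : V -> 'M[F]_(q, r)) dX dY :
  has_diff X v h dX -> has_diff Y v h dY ->
  has_diff (fun w => X w *m Y w) v h (dX *m Y v + X v *m dY).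
Proof.
move=> /has_diff_mxE hX /has_diff_mxE hY; apply/has_diff_mxE => i j.
rewrite !mxE -big_split /= (_ : (fun w => _) = (fun w => \sum_k X w i k * Y w k j)).
  by apply: has_diff_sum => k; exact: has_diffM.
by apply/funext => w; rewrite mxE.
Qed.

Lemma has_diff_trmx p q (X : V -> 'M[F]_(p, q)) dX :
  has_diff X v h dX -> has_diff (fun w => (X w)^T) v h dX^T.
Proof.
move=> /has_diff_mxE hX; apply/has_diff_mxE => i j.
by rewrite mxE (_ : (fun w => _) = (fun w => X w j i)) //; apply/funext => w; rewrite mxE.
Qed.

Lemma has_diff_trace p (X : V -> 'M[F]_p) dX :
  has_diff X v h dX -> has_diff (fun w => \tr (X w)) v h (\tr dX).
Proof. by move=> /has_diff_mxE hX; apply: has_diff_sum => i. Qed.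

Lemma has_diff_scalemx p q (f : V -> F) (X : V -> 'M[F]_(p, q)) df dX :
  has_diff f v h df -> has_diff X v h dX ->
  has_diff (fun w => f w *: X w) v h (df *: X v + f v *: dX).
Proof.
move=> hf /has_diff_mxE hX; apply/has_diff_mxE => i j.
rewrite !mxE (_ : (fun w => _) = (fun w => f w * X w i j)); first exact: has_diffM.
by apply/funext => w; rewrite mxE.
Qed.

Lemma has_diff_id : has_diff (fun w => w) v h h.
Proof. by split; [exact: ex_diff | exact: derive_id]. Qed.

End Rules.

End MatrixDifferentiation.

(** * The smallest singular value of a symmetric positive semidefinite matrix *)

Section SmallestSingularValue.
Variable F : realType.

(** The form attains its minimum lam on the unit sphere at some c.  Then M - lam
    is positive semidefinite and its form vanishes at c, so Cauchy-Schwarz for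
    this form gives (M - lam) c = 0. *)
Lemma rayleigh_minimizer n (M : 'M[F]_n.+1) : M^T = M ->
  exists (lam : F) (x : 'cV[F]_n.+1), [/\ x != 0, M *m x = lam *: x &
    forall y : 'cV[F]_n.+1, lam * \tr (y^T *m y) <= \tr (y^T *m M *m y)].
Proof.
move=> sM.
pose f (N : 'M[F]_n.+1) (v : 'rV[F]_n.+1) := \tr (v *m N *m v^T).
have cf N : continuous (f N).
  move=> v; apply: differentiable_continuous.
  have hv := has_diff_id v 0.
  by have [] := has_diff_trace (has_diff_mulmx
    (has_diff_mulmx hv (has_diff_cst v 0 N)) (has_diff_trmx hv)).
pose S := [set v : 'rV[F]_n.+1 | f 1%:M v = 1].
have fE v : f 1%:M v = frobenius_norm v ^+ 2.
  by rewrite /f mulmx1 fro_sqr mxtrace_mulC.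
have S0 : S !=set0.
  exists (delta_mx 0 0); rewrite /S /= /f mulmx1 trmx_delta mul_delta_mx.
  by rewrite /mxtrace big_ord1 mxE !eqxx.
have cS : compact S.
  apply: bounded_closed_compact; last first.
    apply: (@closed_comp _ _ (f 1%:M) [set 1]) => [v _|]; first exact: cf.
    exact: closed_eq.
  exists 1; split; first exact: num_real.
  move=> K K1 v; rewrite /S /= fE => v1.
  rewrite /Num.Def.normr /= mx_normrE; apply: bigmax_le => [|[i j] _] /=.
    by rewrite (le_trans ler01)// ltW.
  apply: le_trans (ltW K1); rewrite -(@ler_pXn2r _ 2)// ?nnegrE//.
  rewrite expr1n -v1 real_normK ?num_real// fro_sqr mxtr_mulT.
  rewrite (ord1 i) big_ord1 (bigD1 j)//= expr2 lerDl.
  by apply: sumr_ge0 => k _; rewrite -expr2 sqr_ge0.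
have [c] := EVT_min_rV S0 cS (continuous_subspaceT (cf M)).
rewrite inE => Sc cmin.
have c1 : \tr (c *m c^T) = 1 by move: Sc; rewrite /S /= /f mulmx1.
pose lam := f M c; pose N := M - lam%:M.
have formN y : \tr (y^T *m N *m y) = \tr (y^T *m M *m y) - lam * \tr (y^T *m y).
  by rewrite mulmxBr mulmxBl mxtraceB mul_mx_scalar -scalemxAl mxtraceZ.
have sN : N^T = N by rewrite trmxB sM tr_scalar_mx.
have min_lam (y : 'cV[F]_n.+1) : lam * \tr (y^T *m y) <= \tr (y^T *m M *m y).
  have [y0|y0] := eqVneq (frobenius_norm y) 0.
    by rewrite (fro_eq0 y0) !mulmx0 mxtrace0 mulr0.
  have ygt0 : 0 < frobenius_norm y by rewrite lt_neqAle eq_sym y0 fro_ge0.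
  have := cmin ((frobenius_norm y)^-1 *: y^T).
  rewrite inE /S /= fE froZ fro_tr ger0_norm ?invr_ge0 ?fro_ge0// mulVf// expr1n.
  move=> /(_ erefl); rewrite -/lam /f trmxZ trmxK -!scalemxAl -scalemxAr !mxtraceZ.
  rewrite mulrA -expr2 exprVn ler_pdivlMl ?exprn_gt0// -fro_sqr.
  by rewrite mulrC.
have hN : psdmx N by move=> y; rewrite formN subr_ge0.
have cN : \tr ((c^T)^T *m N *m c^T) = 0.
  by rewrite formN !trmxK c1 mulr1 subrr.
exists lam, c^T; split => //.
  apply/eqP => c0; move/eqP: c1; rewrite c0 mulmx0 mxtrace0 eq_sym.
  by rewrite oner_eq0.
have Nc : N *m c^T = 0.
  apply/fro_eq0/eqP; rewrite -sqrf_eq0 fro_sqr trmx_mul sN trmxK.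
  have := psdmx_CauchySchwarz (c^T) (N *m c^T) sN hN; rewrite cN mul0r trmxK.
  set t := \tr _ => t0; have : t ^+ 2 = 0 by apply/le_anti; rewrite t0 sqr_ge0.
  by move=> /eqP; rewrite sqrf_eq0.
by move/eqP: Nc; rewrite mulmxBl subr_eq0 mul_scalar_mx => /eqP.
Qed.

Lemma singular_values_ge0 n (M : 'M[F]_n) : lbound (singular_values M) 0.
Proof. by move=> s []. Qed.

Lemma eigenvector_singular_value n (M : 'M[F]_n) (lam : F) (x : 'cV[F]_n) :
  M^T = M -> 0 <= lam -> x != 0 -> M *m x = lam *: x -> singular_values M lam.
Proof.
move=> sM lam0 x0 Mx; split => //; apply/eigenvalueP; exists x^T.
  apply: trmx_inj; rewrite !trmx_mul !trmxK trmxZ trmxK sM -mulmxA Mx.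
  by rewrite -scalemxAr Mx scalerA expr2.
by apply: contra x0 => /eqP h; rewrite -[x]trmxK h trmx0.
Qed.

(** The least eigenvalue is itself a singular value, since M ^ 2 has the
    eigenvalue lam ^ 2. *)
Lemma sigma_min_le_form n (M : 'M[F]_n) (x : 'cV[F]_n) :
  M^T = M -> psdmx M -> sigma_min M * \tr (x^T *m x) <= \tr (x^T *m M *m x).
Proof.
case: n M x => [|n] M x sM hM.
  by rewrite (flatmx0 x) !mulmx0 mxtrace0 mulr0.
have [lam [y [y0 My lamP]]] := rayleigh_minimizer sM.
apply: le_trans (lamP x); rewrite ler_wpM2r ?mxtr_sqr_ge0//.
apply: ge_inf; first by exists 0; exact: singular_values_ge0.
apply: (eigenvector_singular_value sM _ y0 My).
have := hM y; rewrite -mulmxA My -scalemxAr mxtraceZ pmulr_lge0// -fro_sqr.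
by rewrite exprn_gt0// fro_gt0.
Qed.

(** Every singular value s is at least the least eigenvalue lam > 0: for an
    eigenvector z of M ^ 2, lam |z|^2 <= z^T M z <= |z| |M z| = s |z|^2. *)
Lemma sigma_min_gt0 n (M : 'M[F]_n.+1) : posdefmx M -> 0 < sigma_min M.
Proof.
move=> [sM pM]; have [lam [y [y0 My lamP]]] := rayleigh_minimizer sM.
have form11 (z : 'cV[F]_n.+1) : (z^T *m M *m z) 0 0 = \tr (z^T *m M *m z).
  by rewrite /mxtrace big_ord1.
have lam0 : 0 < lam.
  have := pM y y0; rewrite form11 -mulmxA My -scalemxAr mxtraceZ pmulr_lgt0//.
  by rewrite -fro_sqr exprn_gt0// fro_gt0.
apply: (lt_le_trans lam0); apply: lb_le_inf.
  by exists lam; exact: (eigenvector_singular_value sM (ltW lam0) y0 My).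
move=> s [s0 /eigenvalueP[v vM v0]].
have z0 : v^T != 0 by apply: contra v0 => /eqP h; rewrite -[v]trmxK h trmx0.
have Mz : frobenius_norm (M *m v^T) = s * frobenius_norm v^T.
  apply/eqP; rewrite -(@eqrXn2 _ 2)// ?mulr_ge0 ?fro_ge0// exprMn !fro_sqr.
  rewrite trmx_mul sM trmxK -mxtraceZ mulmxA.
  by rewrite -[v *m M *m M]mulmxA -{1}sM vM scalemxAl.
rewrite -(ler_pM2r (fro_gt0 z0)) -Mz -(ler_pM2r (fro_gt0 z0)).
rewrite -mulrA -expr2 fro_sqr; apply: le_trans (lamP _) _.
rewrite mulrC; apply: le_trans (ler_norm _) _.
by rewrite -mulmxA; exact: mxtr_CauchySchwarz.
Qed.

End SmallestSingularValue.

(** * Discrete Lyapunov equations *)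

Section Lyapunov.
Variable F : realType.

(** Stability is used in this form throughout: unlike the spectral radius, it is
    visibly invariant under transposition and directly usable in limits. *)
Definition power_vanishing n (A : 'M[F]_n) : Prop :=
  (fun t => frobenius_norm (A ^+ t) ^+ 2) @ \oo --> (0 : F).

(** The partial sums converge by monotonicity, so the terms tend to 0. *)
Lemma bounded_sums_cvg0 (u : nat -> F) (c : F) :
  (forall t, 0 <= u t) -> (forall N, \sum_(t < N) u t <= c) ->
  u @ \oo --> (0 : F).
Proof.
move=> u0 uc; apply: cvg_series_cvg_0; apply: nondecreasing_is_cvgn.
  by apply/nondecreasing_seqP => N; rewrite /series /= big_nat_recr//= lerDl.
by exists c => _ [N _ <-]; rewrite /series /= big_mkord.
Qed.

Lemma trmx_exp n (A : 'M[F]_n) t : (A ^+ t)^T = A^T ^+ t.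
Proof. by elim: t => [|t IH]; rewrite ?trmx1// exprS trmx_mul IH [RHS]exprSr. Qed.

Lemma power_vanishing_tr n (A : 'M[F]_n) :
  power_vanishing A -> power_vanishing A^T.
Proof.
rewrite /power_vanishing => vA; rewrite (_ : (fun t => _) =
  (fun t => frobenius_norm (A ^+ t) ^+ 2))//.
by apply/funext => t; rewrite -trmx_exp fro_tr.
Qed.

Lemma form_power_cvg0 n p (A X : 'M[F]_n) (Y : 'M[F]_(n, p)) :
  power_vanishing A ->
  (fun t => \tr ((A ^+ t *m Y)^T *m X *m (A ^+ t *m Y))) @ \oo --> (0 : F).
Proof.
move=> vA; apply: norm_cvg0.
pose b := fun t => frobenius_norm X * frobenius_norm Y ^+ 2 * frobenius_norm (A ^+ t) ^+ 2.
apply: (@squeeze_cvgr _ _ _ _ (cst 0) b); first last.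
- by rewrite -[X in _ --> X](mulr0 (frobenius_norm X * frobenius_norm Y ^+ 2));
  exact: cvgMr.
- exact: cvg_cst.
apply: nearW => t; rewrite normr_ge0 /b -mulmxA /=.
apply: le_trans (mxtr_CauchySchwarz _ _) _.
have h := fro_mulmx (A ^+ t) Y.
apply: (@le_trans _ _ (frobenius_norm X * frobenius_norm (A ^+ t *m Y) ^+ 2)).
  rewrite expr2 mulrCA; apply: ler_wpM2l; [exact: fro_ge0 | exact: fro_mulmx].
rewrite -mulrA -exprMn; apply: ler_wpM2l; first exact: fro_ge0.
by rewrite ler_pXn2r ?nnegrE ?mulr_ge0 ?fro_ge0// [leRHS]mulrC.
Qed.

Lemma stein_iter n (A N X : 'M[F]_n) t : X = N + A^T *m X *m A ->
  X = \sum_(s < t) (A ^+ s)^T *m N *m A ^+ s + (A ^+ t)^T *m X *m A ^+ t.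
Proof.
move=> hX; elim: t => [|t IH].
  by rewrite big_ord0 add0r expr0 trmx1 mul1mx mulmx1.
rewrite {1}IH big_ord_recr /= -addrA; congr (_ + _).
rewrite {1}hX mulmxDr mulmxDl; congr (_ + _).
by rewrite exprS trmx_mul !mulmxA.
Qed.

(** Iterating the equation, the form of X dominates its own value along the
    powers of A, which tends to 0. *)
Lemma stein_psd n (A N X : 'M[F]_n) : power_vanishing A ->
  X = N + A^T *m X *m A -> psdmx N -> psdmx X.
Proof.
move=> vA hX hN x.
have : (fun t => \tr (x^T *m X *m x) - \tr ((A ^+ t *m x)^T *m X *m (A ^+ t *m x)))
   @ \oo --> \tr (x^T *m X *m x) - 0.
  apply: cvgB; first exact: cvg_cst.
  exact: form_power_cvg0.
rewrite subr0 => /cvgr_to_ge; apply; apply: nearW => t.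
rewrite {1}(stein_iter t hX) mulmxDr mulmxDl mxtraceD trmx_mul !mulmxA addrK.
rewrite mulmx_sumr mulmx_suml raddf_sum /=; apply: sumr_ge0 => s _.
have -> : x^T *m ((A ^+ s)^T *m N *m A ^+ s) *m x =
   (A ^+ s *m x)^T *m N *m (A ^+ s *m x) by rewrite trmx_mul !mulmxA.
exact: hN.
Qed.

(** A solution of the homogeneous equation satisfies X = (A^t)^T X A^t for
    every t. *)
Lemma stein_homogeneous n (A X : 'M[F]_n) : power_vanishing A ->
  X = A^T *m X *m A -> X = 0.
Proof.
move=> vA hX; apply: fro_eq0; apply/le_anti; rewrite fro_ge0 andbT.
have : (fun t => frobenius_norm (A ^+ t) ^+ 2 * frobenius_norm X)
   @ \oo --> 0 * frobenius_norm X.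
  by apply: cvgMl.
rewrite mul0r => /cvgr_to_ge; apply; apply: nearW => t.
have hX0 : X = 0 + A^T *m X *m A by rewrite add0r.
rewrite {1}(stein_iter t hX0) big1 ?add0r => [|s _]; last by rewrite mulmx0 mul0mx.
apply: le_trans (fro_mulmx _ _) _.
rewrite expr2 mulrAC ler_wpM2r ?fro_ge0// -[X in _ <= X * _]fro_tr.
exact: fro_mulmx.
Qed.

(** The matrix of X |-> X - A^T X A acting on vectorized matrices. *)
Definition stein_mx n (A : 'M[F]_n) : 'M[F]_(n * n) :=
  1%:M - lin_mulmx A^T *m lin_mulmxr A.

Lemma mul_stein_mx n (A X : 'M[F]_n) :
  mxvec X *m stein_mx A = mxvec (X - A^T *m X *m A).
Proof.
by rewrite mulmxBr mulmx1 mulmxA !mul_vec_lin /= linearB.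
Qed.

Lemma det_stein_neq0 n (A : 'M[F]_n) : power_vanishing A -> \det (stein_mx A) != 0.
Proof.
move=> vA; apply/det0P => -[v v0].
rewrite -[v]vec_mxK mul_stein_mx => /eqP; rewrite mxvec_eq0 subr_eq0 => /eqP h.
by move/eqP: v0; apply; rewrite -[v]vec_mxK (stein_homogeneous vA h) linear0.
Qed.

(** The solution X of X = S + A^T X A when A is stable.  Cramer's formula makes it
    a rational function of the entries of A and S, hence differentiable, with no limit of
    the series of the (A^t)^T S A^t involved. *)
Definition lyap n (A S : 'M[F]_n) : 'M[F]_n :=
  vec_mx ((\det (stein_mx A))^-1 *: (mxvec S *m \adj (stein_mx A))).

Lemma lyap_det n (A S : 'M[F]_n) : \det (stein_mx A) != 0 ->
  lyap A S = S + A^T *m lyap A S *m A.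
Proof.
move=> d0; apply/eqP; rewrite -subr_eq; apply/eqP; apply: (can_inj mxvecK).
rewrite -mul_stein_mx /lyap vec_mxK -scalemxAl -mulmxA mul_adj_mx.
by rewrite mul_mx_scalar scalerA mulVf// scale1r.
Qed.

Lemma lyapE n (A S : 'M[F]_n) : power_vanishing A ->
  lyap A S = S + A^T *m lyap A S *m A.
Proof. by move=> vA; apply: lyap_det; exact: det_stein_neq0. Qed.

Lemma lyap_unique n (A S X : 'M[F]_n) : power_vanishing A ->
  X = S + A^T *m X *m A -> X = lyap A S.
Proof.
move=> vA hX; apply/eqP; rewrite -subr_eq0; apply/eqP.
apply: (stein_homogeneous vA); rewrite {1}hX {1}(lyapE S vA).
by rewrite mulmxBr mulmxBl opprD addrACA subrr add0r.
Qed.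

Lemma lyap_sym n (A S : 'M[F]_n) : power_vanishing A -> S^T = S ->
  (lyap A S)^T = lyap A S.
Proof.
move=> vA sS; apply: lyap_unique => //.
by rewrite {1}lyapE// trmxD !trmx_mul trmxK sS mulmxA.
Qed.

Lemma lyap_psd n (A S : 'M[F]_n) : power_vanishing A -> psdmx S -> psdmx (lyap A S).
Proof. by move=> vA hS; apply: (stein_psd vA (lyapE S vA)). Qed.

Lemma lyapB n (A S S' : 'M[F]_n) : lyap A (S - S') = lyap A S - lyap A S'.
Proof. by rewrite /lyap linearB mulmxBl scalerBr linearB. Qed.

Lemma lyapZ n (a : F) (A S : 'M[F]_n) : lyap A (a *: S) = a *: lyap A S.
Proof.
rewrite /lyap [mxvec (a *: S)]linearZ /= -scalemxAl scalerA mulrC -scalerA.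
by rewrite [LHS]linearZ.
Qed.

(** Both sides equal tr (P Y) - tr (A^T P A Y), where Y = X + A Y A^T. *)
Lemma lyap_adjoint n (A S X P : 'M[F]_n) : power_vanishing A ->
  P = S + A^T *m P *m A -> \tr (P *m X) = \tr (S *m lyap A^T X).
Proof.
move=> vA hP; have hS := lyapE X (power_vanishing_tr vA); rewrite trmxK in hS.
set Y := lyap _ _ in hS *.
have -> : X = Y - A *m Y *m A^T by rewrite {1}hS addrK.
rewrite mulmxBr mxtraceB {1}hP mulmxDl mxtraceD -addrA.
suff -> : \tr (A^T *m P *m A *m Y) = \tr (P *m (A *m Y *m A^T)).
  by rewrite subrr addr0.
by rewrite -!mulmxA mxtrace_mulC !mulmxA.
Qed.

(** A quadratic Lyapunov function forces the powers to vanish: its decrease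
    along the powers makes the squared norms summable. *)
Lemma lyapunov_certificate n (A P : 'M[F]_n) (eps : F) : 0 < eps -> psdmx P ->
  psdmx (P - A^T *m P *m A - eps%:M) -> power_vanishing A.
Proof.
move=> e0 hP hD.
apply: (@bounded_sums_cvg0 _ (eps^-1 * \tr P)) => [t|N]; first exact: sqr_ge0.
have step t : eps * frobenius_norm (A ^+ t) ^+ 2 <=
   \tr ((A ^+ t)^T *m P *m A ^+ t) - \tr ((A ^+ t.+1)^T *m P *m A ^+ t.+1).
  have := psdmx_tr (A ^+ t) hD.
  rewrite !mulmxBr !mulmxBl !mxtraceB mul_mx_scalar -scalemxAl mxtraceZ -fro_sqr.
  by rewrite subr_ge0 (exprS A) trmx_mul !mulmxA.
rewrite ler_pdivlMl// mulr_sumr.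
apply: (@le_trans _ _ (\tr P - \tr ((A ^+ N)^T *m P *m A ^+ N))); last first.
  by rewrite gerBl; exact: psdmx_tr.
elim: N => [|N IH]; first by rewrite big_ord0 expr0 trmx1 mul1mx mulmx1 subrr.
by rewrite big_ord_recr /=; have := step N; lra.
Qed.

End Lyapunov.

(** * Spectral radius smaller than one *)

Section SpectralRadius.
Variable F : realType.
Import Normc.

Lemma normc_ge0 (z : F[i]) : 0 <= normc z.
Proof. by case: z => a b; exact: sqrtr_ge0. Qed.

Lemma ler_normcD (z w : F[i]) : normc (z + w) <= normc z + normc w.
Proof. exact: (@le_normcD F z w). Qed.

Lemma normc_real (a : F) : normc (real_complex F a) = `|a|.
Proof. by rewrite /normc /= expr0n addr0 sqrtr_sqr. Qed.

Definition l1norm n (v : 'cV[F[i]]_n) : F := \sum_i normc (v i 0).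

Lemma l1norm_ge0 n (v : 'cV[F[i]]_n) : 0 <= l1norm v.
Proof. by apply: sumr_ge0 => i _; exact: normc_ge0. Qed.

(** One linear factor A - z is removed at a time: if w = (A - z) v has a summable
    orbit, then so has v, because |A^(t+1) v| <= |z| |A^t v| + |A^t w| with
    |z| < 1, and the sums over t < N on both sides compare without any rate. *)
Lemma orbit_summable n (A : 'M[F[i]]_n.+1) (zs : seq F[i]) (v : 'cV[F[i]]_n.+1) :
  (forall z, z \in zs -> normc z < 1) ->
  horner_mx A (\prod_(z <- zs) ('X - z%:P)) *m v = 0 ->
  exists c, forall N, \sum_(t < N) l1norm (A ^+ t *m v) <= c.
Proof.
elim: zs v => [|z zs IH] v hz.
  rewrite big_nil rmorph1 mul1mx => ->; exists 0 => N.
  rewrite big1// => t _; rewrite mulmx0 /l1norm big1// => i _.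
  by rewrite mxE normc0.
rewrite big_cons mulrC rmorphM /= rmorphB /= horner_mx_X horner_mx_C.
rewrite -mulmxA => hv.
have [|c hc] := IH _ _ hv; first by move=> y yz; apply: hz; rewrite inE yz orbT.
have z1 : normc z < 1 by apply: hz; rewrite inE eqxx.
set w := (A - z%:M) *m v in hv hc.
have Av : A *m v = w + z *: v by rewrite /w mulmxBl mul_scalar_mx subrK.
have step t : l1norm (A ^+ t.+1 *m v) <=
    normc z * l1norm (A ^+ t *m v) + l1norm (A ^+ t *m w).
  rewrite exprSr -mulmxA Av mulmxDr -scalemxAr mulr_sumr -big_split /=.
  apply: ler_sum => i _; rewrite !mxE addrC.
  by apply: le_trans (ler_normcD _ _) _; rewrite normcM.
exists ((l1norm v + c) / (1 - normc z)) => N.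
rewrite ler_pdivlMr ?subr_gt0//.
have mono : \sum_(t < N) l1norm (A ^+ t *m v) <= \sum_(t < N.+1) l1norm (A ^+ t *m v).
  by rewrite big_ord_recr /= lerDl l1norm_ge0.
have : \sum_(t < N.+1) l1norm (A ^+ t *m v) <=
   l1norm v + (normc z * (\sum_(t < N) l1norm (A ^+ t *m v)) + c).
  rewrite big_ord_recl expr0 mul1mx lerD2l.
  apply: le_trans (lerD (lexx _) (hc N)); rewrite mulr_sumr -big_split /=.
  by apply: ler_sum => t _; exact: (step t).
by move: mono; set S := \sum_(t < N) _; set S' := \sum_(t < N.+1) _; lra.
Qed.

Lemma eigenvalue_le_spectral_radius n (M : 'M[F]_n.+1) (z : F[i]) :
  eigenvalue (map_mx (real_complex F) M) z -> normc z <= spectral_radius M.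
Proof.
move=> ev; apply: ub_le_sup; last by exists z.
have [r hr] := closed_field_poly_normal (char_poly (map_mx (real_complex F) M)).
exists (\sum_(y <- r) normc y) => _ [y /= + <-].
rewrite eigenvalue_root_char hr (monicP (char_poly_monic _)) scale1r root_prod_XsubC.
move=> yr; rewrite (big_rem y)//= lerDl.
by apply: sumr_ge0 => x _; exact: normc_ge0.
Qed.

Lemma map_mx_exp n (M : 'M[F]_n.+1) t :
  map_mx (real_complex F) M ^+ t = map_mx (real_complex F) (M ^+ t).
Proof. by elim: t => [|t IH]; rewrite ?map_mx1// !exprS IH map_mxM. Qed.

(** By Cayley-Hamilton the product of the factors A - z over the eigenvalues is
    zero, so the orbit of every basis vector is summable. *)
Lemma spectral_radius_power_vanishing n (M : 'M[F]_n.+1) :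
  spectral_radius M < 1 -> power_vanishing M.
Proof.
move=> rM; set Mc := map_mx (real_complex F) M.
have [r hr] := closed_field_poly_normal (char_poly Mc).
rewrite (monicP (char_poly_monic _)) scale1r in hr.
have r1 z : z \in r -> normc z < 1.
  move=> zr; apply: le_lt_trans rM; apply: eigenvalue_le_spectral_radius.
  by rewrite eigenvalue_root_char hr root_prod_XsubC.
have orb (j : 'I_n.+1) : exists c, forall N,
    \sum_(t < N) l1norm (Mc ^+ t *m delta_mx j (0 : 'I_1)) <= c.
  by apply: (orbit_summable r1); rewrite -hr Cayley_Hamilton mul0mx.
have [c hc] := choice orb.
pose u t := \sum_i \sum_j `|(M ^+ t) i j|.
have uE t : u t = \sum_j l1norm (Mc ^+ t *m delta_mx j (0 : 'I_1)).
  rewrite /u exchange_big /=; apply: eq_bigr => j _; apply: eq_bigr => i _.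
  by rewrite -colE map_mx_exp !mxE normc_real.
have usum N : \sum_(t < N) u t <= \sum_j c j.
  under eq_bigr do rewrite uE.
  by rewrite exchange_big /=; apply: ler_sum => j _; exact: hc.
have u0 t : 0 <= u t by apply: sumr_ge0 => i _; apply: sumr_ge0.
have ule t : u t <= \sum_j c j.
  by apply: le_trans (usum t.+1); rewrite big_ord_recr /= lerDr sumr_ge0.
have leu t i j : `|(M ^+ t) i j| <= u t.
  rewrite /u (bigD1 i)//= (bigD1 j)//= -addrA lerDl addr_ge0// sumr_ge0// => k _.
  exact: sumr_ge0.
(* Each entry is at most the total bound, so squares are at most linear. *)
apply: (@bounded_sums_cvg0 _ _ ((\sum_j c j) * \sum_j c j)) => [t|N].
  exact: sqr_ge0.
apply: (@le_trans _ _ ((\sum_j c j) * \sum_(t < N) u t)); last first.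
  by rewrite ler_wpM2l// (le_trans (u0 0%N)).
rewrite mulr_sumr; apply: ler_sum => t _.
rewrite fro_sqr mxtr_mulT mulr_sumr; apply: ler_sum => i _.
rewrite mulr_sumr; apply: ler_sum => j _.
apply: le_trans (ler_norm _) _; rewrite normrM ler_wpM2r//.
exact: le_trans (leu t i j) (ule t).
Qed.

End SpectralRadius.

(** * The cost as a trace *)

Section CostFormula.
Variables (F : realType) (n m d : nat).
Variables (A : 'M[F]_n) (B : 'M[F]_(n, m)) (C : 'M[F]_(d, n)).
Variables (disp : measure_display) (T : measurableType disp).
Variables (P : probability T F) (x0 : T -> 'cV[F]_n).
Hypothesis x0_moments : finite_second_moments P x0.

Lemma mxtr_mulE (M Y : 'M[F]_n) :
  \tr (M *m Y) = \sum_(p : 'I_n * 'I_n) M p.1 p.2 * Y p.2 p.1.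
Proof.
rewrite /mxtrace; under eq_bigr do rewrite mxE.
by rewrite (pair_big xpredT xpredT (fun i j => M i j * Y j i)).
Qed.

(** The integrand is a finite combination of the integrable products of
    coordinates of x0. *)
Lemma integral_second_moment (M : 'M[F]_n) :
  (\int[P]_w (\tr (M *m (x0 w *m (x0 w)^T)))%:E =
   (\tr (M *m second_moment P x0))%:E)%E.
Proof.
under eq_integral do rewrite mxtr_mulE -sumEFin.
rewrite (@integral_sum _ _ _ P _ measurableT _
  (fun p w => (M p.1 p.2 * (x0 w *m (x0 w)^T) p.2 p.1)%:E)) => [|p]; last first.
  by under eq_fun do rewrite EFinM; apply: integrableZl => //; exact: (x0_moments _ _).
rewrite mxtr_mulE -sumEFin; apply: eq_bigr => p _.
under eq_integral do rewrite EFinM.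
rewrite integralZl//.
rewrite EFinM [in RHS]mxE unlock fineK//.
by apply: integrable_fin_num => //; exact: (x0_moments _ _).
Qed.

Lemma second_moment_sym : (second_moment P x0)^T = second_moment P x0.
Proof.
apply/matrixP => i j; rewrite !mxE; congr (fine 'E_P[_]).
apply/funext => w; rewrite !mxE; apply: eq_bigr => k _.
by rewrite !mxE mulrC.
Qed.

Lemma second_moment_psd : psdmx (second_moment P x0).
Proof.
move=> x; rewrite -mulmxA mxtrace_mulC -mulmxA mxtrace_mulC -lee_fin.
rewrite -integral_second_moment; apply: integral_ge0 => w _; rewrite lee_fin.
rewrite -mulmxA mxtrace_mulC.
by have := mxtr_sqr_ge0 ((x0 w)^T *m x); rewrite trmx_mul trmxK !mulmxA.
Qed.

Variables (Q : 'M[F]_n) (R : 'M[F]_m).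

Definition closed_loop (K : 'M[F]_(m, d)) : 'M[F]_n := A - B *m K *m C.

Definition stage_mx (K : 'M[F]_(m, d)) : 'M[F]_n :=
  Q + C^T *m K^T *m R *m K *m C.

Lemma trajectoryE (K : 'M[F]_(m, d)) x t :
  trajectory A B C K x t = closed_loop K ^+ t *m x.
Proof.
elim: t => [|t IH]; first by rewrite expr0 mul1mx.
rewrite /= IH exprS -mulmxA mulmxBl mulmxN; congr (_ - _).
by rewrite !mulmxA.
Qed.

(** The Lyapunov equation makes the sum telescope: the first N stage costs add up
    to x^T X x minus the same form at the N-th state. *)
Lemma total_cost (K : 'M[F]_(m, d)) x : power_vanishing (closed_loop K) ->
  (\sum_(0 <= t <oo) (stage_cost C Q R K (trajectory A B C K x t))%:E =
   (\tr (x^T *m lyap (closed_loop K) (stage_mx K) *m x))%:E)%E.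
Proof.
move=> vA; set X := lyap _ _.
have hX : X = stage_mx K + (closed_loop K)^T *m X *m closed_loop K by exact: lyapE.
apply: cvg_lim => //.
rewrite (_ : (fun N => _) = EFin \o (fun N => \tr (x^T *m X *m x) -
  \tr ((closed_loop K ^+ N *m x)^T *m X *m (closed_loop K ^+ N *m x)))).
  apply: cvg_EFin; first exact: nearW.
  rewrite -[X in _ --> X]subr0; apply: cvgB; first exact: cvg_cst.
  exact: form_power_cvg0.
apply/funext => N /=; rewrite sumEFin; congr (_%:E).
rewrite big_mkord {1}(stein_iter N hX) mulmxDr mulmxDl mxtraceD.
rewrite trmx_mul !mulmxA addrK mulmx_sumr mulmx_suml raddf_sum /=.
apply: eq_bigr => t _; rewrite /stage_cost trajectoryE trmx_mul.
by rewrite /mxtrace big_ord1 /stage_mx !mulmxA.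
Qed.

Lemma cost_trace (K : 'M[F]_(m, d)) : power_vanishing (closed_loop K) ->
  cost A B C P x0 Q R K =
  \tr (lyap (closed_loop K) (stage_mx K) *m second_moment P x0).
Proof.
move=> vA; rewrite /cost; under eq_integral do rewrite total_cost//.
rewrite -[RHS]/(fine (_%:E)) -integral_second_moment; congr fine.
by apply: eq_integral => w _; rewrite -mulmxA mxtrace_mulC mulmxA.
Qed.

End CostFormula.

(** * Stability is open and the Lyapunov solution is differentiable *)

Section LyapunovDifferentiation.
Variables (F : realType) (V : normedModType F) (n : nat).

Lemma differentiable_near_lt (f : V -> F) (v : V) (c : F) :
  differentiable f v -> f v < c -> \forall w \near v, f w < c.
Proof.
move=> /differentiable_continuous cf fc.
exact: (cvgr_lt _ cf _ fc).
Qed.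

(** The solution P of P = I + A^T P A at the given point remains a Lyapunov
    function nearby: A'^T P A' moves continuously, so P - A'^T P A' still
    dominates I / 2. *)
Lemma power_vanishing_near (Af : V -> 'M[F]_n) (v : V) :
  differentiable Af v -> power_vanishing (Af v) ->
  \forall w \near v, power_vanishing (Af w).
Proof.
move=> dA vA; set P := lyap (Af v) 1%:M.
have hP : P = 1%:M + (Af v)^T *m P *m Af v by exact: lyapE.
have psd1 : psdmx (1%:M : 'M[F]_n) by move=> x; rewrite mulmx1 mxtr_sqr_ge0.
have psdP : psdmx P by exact: lyap_psd.
pose D w := (Af w)^T *m P *m Af w - (Af v)^T *m P *m Af v.
have hA := differentiable_has_diff 0 dA.
have hD := has_diffB (has_diff_mulmx (has_diff_mulmx (has_diff_trmx hA)
  (has_diff_cst v 0 P)) hA) (has_diff_cst v 0 ((Af v)^T *m P *m Af v)).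
have [dg _] := has_diff_trace (has_diff_mulmx (has_diff_trmx hD) hD).
have near_small := @differentiable_near_lt _ _ (2^-1 ^+ 2) dg.
move: near_small; rewrite /= subrr mulmx0 mxtrace0 exprn_gt0//.
move=> /(_ isT); apply: filterS => w.
rewrite -/(D w) -fro_sqr ltr_pXn2r ?nnegrE ?fro_ge0// => Dw.
apply: (@lyapunov_certificate _ _ _ P 2^-1) => // x.
have -> : P - (Af w)^T *m P *m Af w - 2^-1%:M = 2^-1%:M - D w.
  have half : 1%:M = 2^-1%:M + 2^-1%:M :> 'M[F]_n.
    by rewrite -raddfD /=; congr (_%:M); lra.
  rewrite {1}hP /D half; move: (_^T *m P *m Af v) (_^T *m P *m Af w) => X Y.
  by rewrite opprB -!addrA; congr (_ + _); rewrite (addrA X) addrC subrK.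
rewrite mulmxBr mulmxBl mxtraceB mul_mx_scalar -scalemxAl mxtraceZ subr_ge0.
apply: le_trans (ler_norm _) _; rewrite -mulmxA.
apply: le_trans (mxtr_CauchySchwarz _ _) _; rewrite -fro_sqr.
rewrite expr2 mulrA [leRHS]mulrAC mulrC.
apply: ler_wpM2r; first exact: fro_ge0.
apply: le_trans (fro_mulmx _ _) _.
by rewrite ler_wpM2r ?fro_ge0// ltW.
Qed.

Variables (v h : V).

Lemma differentiable_lyap (Af Sf : V -> 'M[F]_n) :
  differentiable Af v -> differentiable Sf v ->
  \det (stein_mx (Af v)) != 0 ->
  differentiable (fun w => lyap (Af w) (Sf w)) v.
Proof.
move=> dA dS d0.
have hA := differentiable_has_diff 0 dA.
have hS := differentiable_has_diff 0 dS.
have hM := has_diffB (has_diff_cst v 0 (1%:M : 'M[F]_(n * n)))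
  (has_diff_mulmx (has_diff_linmx (@lin_mulmx F n n n) (has_diff_trmx hA))
     (has_diff_linmx (@lin_mulmxr F n n n) hA)).
have [dM _] := hM.
have dinv := differentiableV (differentiable_det dM) d0.
have hinv := differentiable_has_diff 0 dinv.
have hadj := differentiable_has_diff 0 (differentiable_adj dM).
by have [] := has_diff_linmx (@vec_mx F n n) (has_diff_scalemx hinv
  (has_diff_mulmx (has_diff_linmx (@mxvec F n n) hS) hadj)).
Qed.

(** Once differentiability is known from Cramer's formula, differentiating the
    equation itself shows that the derivative solves a Lyapunov equation with
    the same A. *)
Lemma has_diff_lyap (Af Sf : V -> 'M[F]_n) dA dS :
  has_diff Af v h dA -> has_diff Sf v h dS -> power_vanishing (Af v) ->
  has_diff (fun w => lyap (Af w) (Sf w)) v h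
    (lyap (Af v) (dS + dA^T *m lyap (Af v) (Sf v) *m Af v
                     + (Af v)^T *m lyap (Af v) (Sf v) *m dA)).
Proof.
move=> hA hS vA.
have dX : differentiable (fun w => lyap (Af w) (Sf w)) v.
  by apply: differentiable_lyap; [case: hA|case: hS|exact: det_stein_neq0].
have hX := differentiable_has_diff h dX.
split => //; apply: (lyap_unique vA).
have [_ dR] := has_diffD hS (has_diff_mulmx (has_diff_mulmx (has_diff_trmx hA) hX) hA).
rewrite [LHS](_ : _ = 'D_h (fun w => Sf w + (Af w)^T *m lyap (Af w) (Sf w) *m Af w) v).
  rewrite dR mulmxDl -!addrA; congr (_ + (_ + _)); exact: addrC.
apply: near_eq_derive.
have [dA' _] := hA; apply: filterS (power_vanishing_near dA' vA) => w vw.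
exact: lyapE.
Qed.

End LyapunovDifferentiation.

(** * First and second derivatives of the cost *)

Section CostDerivatives.
Variables (F : realType) (n m d : nat).
Variables (A : 'M[F]_n) (B : 'M[F]_(n, m)) (C : 'M[F]_(d, n)).
Variables (Q : 'M[F]_n) (R : 'M[F]_m) (X0 : 'M[F]_n).
Hypotheses (symQ : Q^T = Q) (symR : R^T = R) (symX0 : X0^T = X0).
Implicit Types (K E G : 'M[F]_(m, d)).

Local Notation cl K := (closed_loop A B C K).

Lemma mxtr_rot (W M S N : 'M[F]_n) :
  \tr (W *m (M *m S *m N^T)) = \tr (N^T *m W *m M *m S).
Proof. by rewrite mulmxA mxtrace_mulC !mulmxA. Qed.

Lemma mxtr_sym_rot (W M S N : 'M[F]_n) : W^T = W -> S^T = S ->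
  \tr (W *m (N *m S *m M^T)) = \tr (N^T *m W *m M *m S).
Proof.
move=> sW sS; rewrite -mxtr_rot -[LHS]mxtrace_tr !trmx_mul trmxK sW sS.
by rewrite [RHS]mxtrace_mulC !mulmxA.
Qed.

Lemma value_sourceE (X M : 'M[F]_n) K E : X^T = X ->
  C^T *m E^T *m R *m K *m C + C^T *m K^T *m R *m E *m C
    + (- (B *m E *m C))^T *m X *m M + M^T *m X *m - (B *m E *m C) =
  C^T *m E^T *m (R *m K *m C - B^T *m X *m M)
    + (R *m K *m C - B^T *m X *m M)^T *m E *m C.
Proof.
move=> sX; rewrite trmxB !raddfN /= !trmx_mul trmxK sX symR.
rewrite !mulmxBr !mulmxBl !mulNmx !mulmxA.
by rewrite -addrA addrACA.
Qed.

(** The matrix P_K of the cost x^T P_K x from the initial state x. *)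
Definition value_mx K : 'M[F]_n := lyap (cl K) (stage_mx C Q R K).

(** For a stabilizing K, the sum over t of the second moments of the states x_t. *)
Definition state_mx K : 'M[F]_n := lyap (cl K)^T X0.

Definition policy_residual K : 'M[F]_(m, n) :=
  R *m K *m C - B^T *m value_mx K *m cl K.

Definition cost_gradient K : 'M[F]_(m, d) :=
  2 *: (policy_residual K *m state_mx K *m C^T).

(** The derivative in K, along E, of the right-hand side of the Lyapunov equation
    of the value matrix, with that matrix held fixed. *)
Definition value_source K E : 'M[F]_n :=
  C^T *m E^T *m policy_residual K + (policy_residual K)^T *m E *m C.

Definition value_diff K E : 'M[F]_n := lyap (cl K) (value_source K E).

Definition state_diff K E : 'M[F]_n :=
  lyap (cl K)^T (- (B *m E *m C *m state_mx K *m (cl K)^T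
                    + cl K *m state_mx K *m (B *m E *m C)^T)).

Definition cost_hessian K E : 'M[F]_(m, d) :=
  2 *: ((R *m E *m C + B^T *m value_mx K *m (B *m E *m C)
          - B^T *m value_diff K E *m cl K) *m state_mx K *m C^T
        + policy_residual K *m state_diff K E *m C^T).

Lemma stage_mx_sym K : (stage_mx C Q R K)^T = stage_mx C Q R K.
Proof. by rewrite trmxD !trmx_mul !trmxK symQ symR !mulmxA. Qed.

Section AtStablePoint.
Variable K : 'M[F]_(m, d).
Hypothesis stableK : power_vanishing (cl K).

Lemma value_mx_sym : (value_mx K)^T = value_mx K.
Proof. by apply: lyap_sym => //; exact: stage_mx_sym. Qed.

Lemma state_mx_sym : (state_mx K)^T = state_mx K.
Proof. by apply: lyap_sym => //; exact: power_vanishing_tr. Qed.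

Lemma value_source_sym E : (value_source K E)^T = value_source K E.
Proof. by rewrite trmxD !trmx_mul !trmxK !mulmxA addrC. Qed.

Lemma value_diff_sym E : (value_diff K E)^T = value_diff K E.
Proof. by apply: lyap_sym => //; exact: value_source_sym. Qed.

Lemma state_mxE : state_mx K = X0 + cl K *m state_mx K *m (cl K)^T.
Proof.
by rewrite {1}/state_mx (lyapE _ (power_vanishing_tr stableK)) trmxK.
Qed.

Lemma state_diff_sym E : (state_diff K E)^T = state_diff K E.
Proof.
apply: lyap_sym; first exact: power_vanishing_tr.
by rewrite raddfN /= trmxD !trmx_mul !trmxK state_mx_sym !mulmxA addrC.
Qed.

(** Adjointness of the two Lyapunov operators replaces the derivative of the
    value matrix, paired with X0, by its source, paired with the state matrix. *)
Lemma cost_gradient_pair E :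
  \tr (value_diff K E *m X0) = \tr ((cost_gradient K)^T *m E).
Proof.
rewrite (lyap_adjoint X0 stableK (lyapE (value_source K E) stableK)).
rewrite -/(state_mx K) mulmxDl mxtraceD trmxZ -scalemxAl mxtraceZ.
rewrite [2]mulr2n mulrDl mul1r; congr (_ + _); last first.
  rewrite !trmx_mul trmxK state_mx_sym -!mulmxA.
  by rewrite [RHS]mxtrace_mulC -!mulmxA [RHS]mxtrace_mulC -!mulmxA.
rewrite -[LHS]mxtrace_tr !trmx_mul !trmxK state_mx_sym -!mulmxA.
by rewrite [RHS]mxtrace_mulC -!mulmxA.
Qed.

(** The derivative of the state matrix along E is moved by adjointness onto the
    derivative of the value matrix along G, which leaves an expression
    symmetric in E and G that involves only one state matrix. *)
Lemma cost_hessian_pair E G :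
  \tr (G^T *m cost_hessian K E) =
  2 * (\tr ((G *m C)^T *m R *m (E *m C) *m state_mx K)
       + \tr ((B *m G *m C)^T *m value_mx K *m (B *m E *m C) *m state_mx K)
       - \tr ((B *m G *m C)^T *m value_diff K E *m cl K *m state_mx K)
       - \tr ((B *m E *m C)^T *m value_diff K G *m cl K *m state_mx K)).
Proof.
rewrite -scalemxAr mxtraceZ; congr (_ * _).
have expand (a b c : 'M[F]_(m, n)) (S : 'M[F]_n) (t : 'M[F]_(m, d)) :
    \tr (G^T *m ((a + b - c) *m S *m C^T + t)) = \tr (G^T *m (a *m S *m C^T))
    + \tr (G^T *m (b *m S *m C^T)) - \tr (G^T *m (c *m S *m C^T))
    + \tr (G^T *m t).
  by rewrite !mulmxDl !mulNmx !mulmxDr mulmxN !mxtraceD [\tr (- _)]raddfN.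
rewrite expand.
rewrite -!addrA; congr (_ + (_ + (_ + _))).
- by rewrite trmx_mul -!mulmxA [RHS]mxtrace_mulC -!mulmxA.
- by rewrite !trmx_mul -!mulmxA [RHS]mxtrace_mulC -!mulmxA.
- by congr (- _); rewrite !trmx_mul -!mulmxA [RHS]mxtrace_mulC -!mulmxA.
have two_neq0 : 2 != 0 :> F by [].
apply: (mulfI two_neq0).
have -> : 2 * \tr (G^T *m (policy_residual K *m state_diff K E *m C^T)) =
  \tr (value_source K G *m state_diff K E).
  rewrite [value_source K G *m _]mulmxDl mxtraceD [2]mulr2n mulrDl mul1r; congr (_ + _).
    by rewrite -!mulmxA [RHS]mxtrace_mulC -!mulmxA.
  rewrite -[RHS]mxtrace_tr !trmx_mul trmxK state_diff_sym -!mulmxA.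
  by rewrite [RHS]mxtrace_mulC -!mulmxA [RHS]mxtrace_mulC -!mulmxA.
rewrite -(lyap_adjoint _ stableK (lyapE (value_source K G) stableK)) -/(value_diff K G).
rewrite mulmxN raddfN /= mulmxDr mxtraceD mulrN [2]mulr2n mulrDl mul1r.
congr (- (_ + _)).
- exact: mxtr_sym_rot (value_diff_sym G) state_mx_sym.
- exact: mxtr_rot.
Qed.

End AtStablePoint.

(** The gain is a differentiable function kappa of a parameter in an arbitrary
    normed space.  The same rules then serve for the gain itself, for its
    vectorization and for a segment of gains. *)
Section AlongParametrization.
Variables (V : normedModType F) (kappa : V -> 'M[F]_(m, d)).
Variables (v h : V) (E : 'M[F]_(m, d)).
Hypotheses (dkappa : has_diff kappa v h E) (stable_v : power_vanishing (cl (kappa v))).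

Lemma has_diff_closed_loop : has_diff (fun w => cl (kappa w)) v h (- (B *m E *m C)).
Proof.
have := has_diffB (has_diff_cst v h A) (has_diff_mulmx (has_diff_mulmx
  (has_diff_cst v h B) dkappa) (has_diff_cst v h C)).
by rewrite mul0mx mulmx0 sub0r add0r addr0.
Qed.

Lemma has_diff_value_mx :
  has_diff (fun w => value_mx (kappa w)) v h (value_diff (kappa v) E).
Proof.
have dC p q (M : 'M[F]_(p, q)) := has_diff_cst v h M.
have dS : has_diff (fun w => stage_mx C Q R (kappa w)) v h
    (C^T *m E^T *m R *m kappa v *m C + C^T *m (kappa v)^T *m R *m E *m C).
  apply: (has_diff_eq (has_diffD (dC _ _ Q) (has_diff_mulmx (has_diff_mulmx
    (has_diff_mulmx (has_diff_mulmx (dC _ _ C^T) (has_diff_trmx dkappa))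
      (dC _ _ R)) dkappa) (dC _ _ C)))).
  by rewrite !(mul0mx, mulmx0, add0r, addr0) mulmxDl.
apply: (has_diff_eq (has_diff_lyap has_diff_closed_loop dS stable_v)).
congr (lyap _ _); exact: value_sourceE (value_mx_sym stable_v).
Qed.

Lemma has_diff_state_mx :
  has_diff (fun w => state_mx (kappa w)) v h (state_diff (kappa v) E).
Proof.
apply: (has_diff_eq (has_diff_lyap (has_diff_trmx has_diff_closed_loop)
  (has_diff_cst v h X0) (power_vanishing_tr stable_v))).
rewrite -/(state_mx _) !trmxK /state_diff; congr (lyap _ _).
by rewrite add0r !raddfN /= !mulNmx -opprD.
Qed.

Lemma has_diff_trace_cost :
  has_diff (fun w => \tr (value_mx (kappa w) *m X0)) v h
           (\tr ((cost_gradient (kappa v))^T *m E)).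
Proof.
apply: (has_diff_eq
  (has_diff_trace (has_diff_mulmx has_diff_value_mx (has_diff_cst v h X0)))).
by rewrite mulmx0 addr0; exact: cost_gradient_pair.
Qed.

Lemma has_diff_cost_gradient :
  has_diff (fun w => cost_gradient (kappa w)) v h (cost_hessian (kappa v) E).
Proof.
have dC p q (M : 'M[F]_(p, q)) := has_diff_cst v h M.
have dG := has_diffB
  (has_diff_mulmx (has_diff_mulmx (dC _ _ R) dkappa) (dC _ _ C))
  (has_diff_mulmx (has_diff_mulmx (dC _ _ B^T) has_diff_value_mx) has_diff_closed_loop).
apply: (has_diff_eq (has_diff_scalemx (has_diff_cst v h (2 : F))
  (has_diff_mulmx (has_diff_mulmx dG has_diff_state_mx) (dC _ _ C^T)))).
rewrite scale0r add0r !(mul0mx, mulmx0, add0r, addr0) /cost_hessian.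
congr (_ *: _); rewrite mulmxDl; congr (_ *m _ *m _ + _).
by rewrite mulmxN opprD opprK -!addrA; congr (_ + _); rewrite addrC.
Qed.

End AlongParametrization.

End CostDerivatives.

(** * Bounding the Hessian form *)

(** ** Two scalar estimates *)

Section ScalarEstimates.
Variable F : realFieldType.

Lemma source_estimate (a b c r sigma x2 : F) (yRy zRz yRz pPp qPq pPq xPx xQx : F) :
  0 <= a -> 0 <= b -> 0 <= c -> 0 <= r -> 0 < sigma -> sigma * x2 <= xQx ->
  2 * (1 * yRz) <= yRy + zRz -> 2 * (-1 * pPq) <= pPp + qPq ->
  zRz + qPq = xPx - xQx ->
  yRy <= r * (c * x2) -> pPp <= a * (c * b * x2) -> xPx <= a * x2 ->
  2 * yRz - 2 * pPq <= (1 / sigma * ((1 + c * b) * a + c * r) - 1) * xQx.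
Proof.
move=> a0 b0 c0 r0 sigma0 xQ yR pP lyapx yRy_le pPp_le xPx_le.
set k := (1 + c * b) * a + c * r.
have k0 : 0 <= k by rewrite addr_ge0 ?mulr_ge0 ?addr_ge0 ?mulr_ge0.
have kx : k * x2 <= k / sigma * xQx by rewrite -mulrA ler_wpM2l// ler_pdivlMl.
have -> : (1 / sigma * k - 1) * xQx = k / sigma * xQx - xQx by ring.
have : k * x2 = a * x2 + a * (c * b * x2) + r * (c * x2) by rewrite /k; ring.
lra.
Qed.

(** Adding the four bounds, the quotient by nC cancels against nC ^ 2; for
    nC = 0 both sides vanish. *)
Lemma hessian_estimate (nB nC nR a s z f t1 t2 t3 t4 : F) :
  0 < nB -> 0 <= nC -> 0 <= nR -> 0 <= a -> 0 <= z -> f ^+ 2 <= s ->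
  `|t1| <= (nC * f) * (nR * (nC * f)) ->
  `|t2| <= (nB * (nC * f)) * (a * (nB * (nC * f))) ->
  `|t3| <= (nB * (nC * f)) * (z * a * f) ->
  `|t4| <= (nB * (nC * f)) * (z * a * f) ->
  `|2 * (t1 + t2 - t3 - t4)| <=
    2 * nC ^+ 2 * (nR + nB ^+ 2 * (1 + 2 * z / (nC * nB)) * a) * s.
Proof.
move=> B0 C0 R0 a0 z0 f2; rewrite !ler_norml.
move=> /andP[h1 h1'] /andP[h2 h2'] /andP[h3 h3'] /andP[h4 h4'].
pose c := nC ^+ 2 * nR + nB ^+ 2 * nC ^+ 2 * a + 2 * (nB * nC * z * a).
have nB0 := ltW B0.
have c0 : 0 <= c by rewrite !addr_ge0 ?mulr_ge0 ?sqr_ge0.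
have -> : 2 * nC ^+ 2 * (nR + nB ^+ 2 * (1 + 2 * z / (nC * nB)) * a) * s = 2 * (c * s).
  rewrite /c; have [->|nC0] := eqVneq nC 0; first by ring.
  by field; rewrite nC0 gt_eqF.
have cs : c * f ^+ 2 <= c * s by exact: ler_wpM2l.
have cf : c * f ^+ 2 = (nC * f) * (nR * (nC * f)) +
  (nB * (nC * f)) * (a * (nB * (nC * f))) + 2 * ((nB * (nC * f)) * (z * a * f)).
  by rewrite /c; ring.
by apply/andP; split; lra.
Qed.

End ScalarEstimates.

Section HessianBound.
Variables (F : realType) (n m d : nat).
Variables (A : 'M[F]_n.+1) (B : 'M[F]_(n.+1, m)) (C : 'M[F]_(d, n.+1)).
Variables (Q : 'M[F]_n.+1) (R : 'M[F]_m) (X0 : 'M[F]_n.+1).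
Hypotheses (posQ : posdefmx Q) (posR : posdefmx R).
Hypotheses (symX0 : X0^T = X0) (psdX0 : psdmx X0) (mu_gt0 : 0 < sigma_min X0).
Variables (K : 'M[F]_(m, d)) (alpha : F).
Hypothesis stableK : power_vanishing (closed_loop A B C K).

Local Notation Acl := (closed_loop A B C K).
Local Notation S := (stage_mx C Q R K).
Local Notation P := (value_mx A B C Q R K).
Local Notation Sigma := (state_mx A B C X0 K).
Local Notation W := (value_diff A B C Q R K).
Local Notation nB := (spectral_norm B).
Local Notation nC := (spectral_norm C).
Local Notation nR := (spectral_norm R).
Local Notation a := (alpha / sigma_min X0).
Local Notation s := (alpha / sigma_min Q).

Hypothesis cost_le : \tr (P *m X0) <= alpha.

Lemma posdef_sym p (M : 'M[F]_p) : posdefmx M -> M^T = M.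
Proof. by case. Qed.

Lemma posdef_psd p (M : 'M[F]_p) : posdefmx M -> psdmx M.
Proof.
move=> [_ pM] x; have [->|x0] := eqVneq x 0; first by rewrite mulmx0 mxtrace0.
by rewrite /mxtrace big_ord1 ltW// pM.
Qed.

Let symQ := posdef_sym posQ.
Let symR := posdef_sym posR.
Let sigmaQ_gt0 := sigma_min_gt0 posQ.

Lemma sigma_min_psd p (M : 'M[F]_p) : M^T = M -> psdmx M ->
  psdmx (M - (sigma_min M)%:M).
Proof.
move=> sM hM x; rewrite mulmxBr mulmxBl mxtraceB mul_mx_scalar -scalemxAl.
by rewrite mxtraceZ subr_ge0 sigma_min_le_form.
Qed.

Lemma stage_mx_psd_sub : psdmx (S - Q).
Proof.
rewrite addrC addKr.
have := psdmx_conj (K *m C) (posdef_psd posR).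
by rewrite trmx_mul !mulmxA.
Qed.

Lemma value_mx_psd : psdmx P.
Proof.
apply: lyap_psd => //; rewrite -[stage_mx _ _ _ _](subrK Q).
by apply: psdmxD; [exact: stage_mx_psd_sub | exact: posdef_psd].
Qed.

Lemma state_mx_psd : psdmx Sigma.
Proof. by apply: lyap_psd => //; exact: power_vanishing_tr. Qed.

(** X0 - mu I is positive semidefinite, so mu tr P <= tr (P X0), the cost. *)
Lemma trace_value_le : \tr P <= a.
Proof.
rewrite (ler_pdivlMr _ _ mu_gt0) [leLHS]mulrC; apply: le_trans cost_le.
have := psdmx_tr_mul_ge0 (sigma_min_psd symX0 psdX0)
  (value_mx_sym symQ symR stableK) value_mx_psd.
by rewrite mulmxBl mxtraceB mul_scalar_mx mxtraceZ subr_ge0 mxtrace_mulC.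
Qed.

(** By adjointness the cost is also the trace of the stage matrix times the state
    matrix, and the stage matrix dominates sigma_min Q times the identity. *)
Lemma trace_state_le : \tr Sigma <= s.
Proof.
rewrite (ler_pdivlMr _ _ sigmaQ_gt0) [leLHS]mulrC; apply: le_trans cost_le.
rewrite (lyap_adjoint X0 stableK (lyapE S stableK)) -/Sigma.
have hS : psdmx (S - (sigma_min Q)%:M).
  rewrite -[S](subrK Q) -addrA; apply: psdmxD; first exact: stage_mx_psd_sub.
  exact: (sigma_min_psd symQ (posdef_psd posQ)).
have := psdmx_tr_mul_ge0 hS (state_mx_sym symX0 stableK) state_mx_psd.
by rewrite mulmxBl mxtraceB mul_scalar_mx mxtraceZ subr_ge0.
Qed.

Lemma trace_bound_ge0 : 0 <= a.
Proof.
apply: le_trans trace_value_le.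
by have := psdmx_tr 1%:M value_mx_psd; rewrite trmx1 mul1mx mulmx1.
Qed.

Lemma value_form_le (x : 'cV[F]_n.+1) :
  \tr (x^T *m P *m x) <= a * frobenius_norm x ^+ 2.
Proof.
rewrite fro_sqr; apply: le_trans (psdmx_le_tr _ _ value_mx_psd) _.
  exact: value_mx_sym.
by rewrite ler_wpM2r ?mxtr_sqr_ge0 ?trace_value_le.
Qed.

Definition zeta : F :=
  1 / sigma_min Q * ((1 + nC ^+ 2 * nB ^+ 2) * a + nC ^+ 2 * nR) - 1.

Lemma form_addT p (M : 'M[F]_p) (x : 'cV[F]_p) :
  \tr (x^T *m (M + M^T) *m x) = 2 * \tr (x^T *m M *m x).
Proof.
rewrite mulmxDr mulmxDl mxtraceD -[X in _ + X]mxtrace_tr !trmx_mul !trmxK mulmxA.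
by rewrite [2]mulr2n mulrDl mul1r.
Qed.

Lemma form_young p (M : 'M[F]_p) (x y : 'cV[F]_p) (e : F) : e ^+ 2 = 1 ->
  M^T = M -> psdmx M ->
  2 * (e * \tr (x^T *m M *m y)) <= \tr (x^T *m M *m x) + \tr (y^T *m M *m y).
Proof.
move=> e1 sM hM; have := hM (1 *: x + (- e) *: y).
by rewrite form_polar// sqrrN e1 expr1n; lra.
Qed.

(** The form of the source is 2 (y^T R z - p^T P q) with y = E C x, z = K C x,
    p = B y and q = A_K x.  After Young's inequality, the Lyapunov equation
    evaluates z^T R z + q^T P q as x^T (P - Q) x; the remaining terms are at
    most a multiple of |x|^2, hence of x^T Q x, and the term - x^T Q x is where
    the summand - 1 in zeta comes from. *)
Lemma value_source_le (E : 'M[F]_(m, d)) (x : 'cV[F]_n.+1) :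
  frobenius_norm E <= 1 ->
  \tr (x^T *m value_source A B C Q R K E *m x) <= zeta * \tr (x^T *m Q *m x).
Proof.
move=> E1.
set y := E *m C *m x; set z := K *m C *m x.
set p := B *m y; set q := Acl *m x.
have -> : \tr (x^T *m value_source A B C Q R K E *m x) =
    2 * \tr (y^T *m R *m z) - 2 * \tr (p^T *m P *m q).
  have -> : value_source A B C Q R K E = C^T *m E^T *m policy_residual A B C Q R K
     + (C^T *m E^T *m policy_residual A B C Q R K)^T.
    by rewrite /value_source !trmx_mul !trmxK !mulmxA.
  rewrite form_addT /policy_residual mulmxBr mulmxBr mulmxBl mxtraceB mulrBr.
  congr (2 * _ - 2 * _).
    by rewrite /y /z !trmx_mul !mulmxA.
  by rewrite /p /q /y !trmx_mul !mulmxA.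
have psdR := posdef_psd posR.
have yR := @form_young _ R y z 1 (expr1n _ 2) symR psdR.
have sqrN1 : (-1) ^+ 2 = 1 :> F by rewrite sqrrN expr1n.
have pP := @form_young _ P p q (-1) sqrN1 (value_mx_sym symQ symR stableK) value_mx_psd.
have lyapx : \tr (z^T *m R *m z) + \tr (q^T *m P *m q) =
    \tr (x^T *m P *m x) - \tr (x^T *m Q *m x).
  have -> : \tr (x^T *m P *m x) =
     \tr (x^T *m (S + Acl^T *m P *m Acl) *m x).
    by congr (\tr (_ *m _ *m _)); exact: lyapE.
  rewrite mulmxDr mulmxDl mxtraceD {1}/stage_mx mulmxDr mulmxDl mxtraceD.
  rewrite -[X in _ = X - _]addrA [RHS]addrAC subrr add0r; congr (_ + _).
    by rewrite /z !trmx_mul !mulmxA.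
  by rewrite /q !trmx_mul !mulmxA.
have fy : frobenius_norm y <= nC * frobenius_norm x.
  rewrite /y -mulmxA; apply: le_trans (fro_mulmx _ _) _.
  rewrite -[leRHS]mul1r; apply: ler_pM; rewrite ?fro_ge0//.
  exact: spectral_norm_fro.
have fp : frobenius_norm p <= nB * (nC * frobenius_norm x).
  apply: le_trans (spectral_norm_fro _ _) _.
  by rewrite ler_wpM2l ?spectral_norm_ge0.
have fy2 : frobenius_norm y ^+ 2 <= nC ^+ 2 * frobenius_norm x ^+ 2.
  by rewrite -exprMn ler_pXn2r ?nnegrE ?mulr_ge0 ?fro_ge0 ?spectral_norm_ge0.
have fp2 : frobenius_norm p ^+ 2 <= nC ^+ 2 * nB ^+ 2 * frobenius_norm x ^+ 2.
  rewrite -!exprMn ler_pXn2r ?nnegrE ?mulr_ge0 ?fro_ge0 ?spectral_norm_ge0//.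
  by apply: le_trans fp _; rewrite mulrA [nB * _]mulrC.
have yRy : \tr (y^T *m R *m y) <= nR * (nC ^+ 2 * frobenius_norm x ^+ 2).
  apply: le_trans (ler_norm _) _; rewrite -mulmxA.
  apply: le_trans (mxtr_CauchySchwarz _ _) _.
  apply: (@le_trans _ _ (nR * frobenius_norm y ^+ 2)).
    by rewrite expr2 mulrCA ler_wpM2l ?fro_ge0 ?spectral_norm_fro.
  by rewrite ler_wpM2l ?spectral_norm_ge0.
have pPp : \tr (p^T *m P *m p) <= a * (nC ^+ 2 * nB ^+ 2 * frobenius_norm x ^+ 2).
  by apply: le_trans (value_form_le _) _; rewrite ler_wpM2l ?trace_bound_ge0.
have xPx := value_form_le x.
have xQx : sigma_min Q * frobenius_norm x ^+ 2 <= \tr (x^T *m Q *m x).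
  by rewrite fro_sqr; apply: sigma_min_le_form => //; exact: posdef_psd.
exact: (source_estimate trace_bound_ge0 (sqr_ge0 nB) (sqr_ge0 nC) (spectral_norm_ge0 R)
  sigmaQ_gt0 xQx yR pP lyapx yRy pPp xPx).
Qed.

(** The direction E = 0 in the previous estimate gives 0 <= zeta x^T Q x. *)
Lemma zeta_ge0 : 0 <= zeta.
Proof.
pose x : 'cV[F]_n.+1 := delta_mx 0 0.
have x0 : x != 0.
  by apply/eqP => /matrixP/(_ 0 0); rewrite !mxE !eqxx => /eqP; rewrite oner_eq0.
have := @value_source_le 0 x; rewrite fro0 => /(_ ler01).
rewrite /value_source trmx0 !(mulmx0, mul0mx, add0r) mxtrace0.
by rewrite pmulr_lge0// /mxtrace big_ord1; case: posQ => _; apply.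
Qed.

Lemma value_sourceZ (e : F) (E : 'M[F]_(m, d)) :
  value_source A B C Q R K (e *: E) = e *: value_source A B C Q R K E.
Proof.
by rewrite /value_source trmxZ -!(scalemxAr, scalemxAl) -scalerDr.
Qed.

(** zeta P and W E solve Lyapunov equations with the same A_K, and the source
    zeta S of the first dominates that of the second since S dominates Q. *)
Lemma value_diff_le (E : 'M[F]_(m, d)) :
  frobenius_norm E <= 1 -> psdmx (zeta *: P - W E).
Proof.
move=> E1; rewrite /value_mx /value_diff -lyapZ -lyapB; apply: lyap_psd => //.
rewrite -[S](subrK Q) scalerDr -addrA; apply: psdmxD.
  by apply: psdmxZ; [exact: zeta_ge0 | exact: stage_mx_psd_sub].
move=> x; rewrite mulmxBr mulmxBl mxtraceB subr_ge0 -scalemxAr -scalemxAl mxtraceZ.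
exact: value_source_le.
Qed.

(** The estimate for E and for - E encloses W E between - zeta P and zeta P. *)
Lemma value_diff_norm_le p (E : 'M[F]_(m, d)) (X : 'M[F]_(n.+1, p)) :
  frobenius_norm E <= 1 ->
  frobenius_norm (W E *m X) <= zeta * a * frobenius_norm X.
Proof.
move=> E1; apply: sym_form_bound_norm.
- exact: value_diff_sym.
- by rewrite mulr_ge0 ?zeta_ge0 ?trace_bound_ge0.
move=> x; rewrite -fro_sqr -mulrA.
apply: (@le_trans _ _ (zeta * \tr (x^T *m P *m x))); last first.
  by rewrite ler_wpM2l ?zeta_ge0 ?value_form_le.
have EN1 : frobenius_norm (- 1 *: E) <= 1 by rewrite froZ normrN1 mul1r.
have WN : W (- 1 *: E) = - 1 *: W E by rewrite /value_diff value_sourceZ lyapZ.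
have := value_diff_le E1 x; have := value_diff_le EN1 x; rewrite WN.
have formB (c : F) (M N : 'M[F]_n.+1) :
    \tr (x^T *m (zeta *: M - c *: N) *m x) =
    zeta * \tr (x^T *m M *m x) - c * \tr (x^T *m N *m x).
  rewrite mulmxBr mulmxBl mxtraceB -!scalemxAr -!scalemxAl.
  by rewrite !mxtraceZ.
rewrite -[X in _ -> 0 <= \tr (_ *m (_ - X) *m _) -> _]scale1r !formB ler_norml.
move: (\tr (x^T *m W E *m x)) (\tr (x^T *m P *m x)) => w y h1 h2.
by apply/andP; split; lra.
Qed.

Lemma value_mx_norm_le p (X : 'M[F]_(n.+1, p)) :
  frobenius_norm (P *m X) <= a * frobenius_norm X.
Proof.
apply: sym_form_bound_norm; [exact: value_mx_sym|exact: trace_bound_ge0|].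
by move=> x; rewrite -fro_sqr ger0_norm ?value_form_le//; exact: value_mx_psd.
Qed.

Definition smoothness_constant : F :=
  2 * nC ^+ 2 * (nR + nB ^+ 2 * (1 + 2 * zeta / (nC * nB)) * a) * s.

(** Writing the state matrix as Z Z^T turns every term of the bilinear form into
    a Frobenius inner product.  The factors E C Z and G C Z have norm at most
    nC |Z|, and A_K Z has norm at most |Z| because A_K Sigma A_K^T is Sigma - X0. *)
Lemma cost_hessian_le (E G : 'M[F]_(m, d)) : B != 0 ->
  frobenius_norm E <= 1 -> frobenius_norm G <= 1 ->
  `|\tr (G^T *m cost_hessian A B C Q R X0 K E)| <= smoothness_constant.
Proof.
move=> B0 E1 G1.
have [r [Z SZ]] := psdmx_factor (state_mx_sym symX0 stableK) state_mx_psd.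
set f := frobenius_norm Z.
have f0 : 0 <= f by exact: fro_ge0.
have f2 : f ^+ 2 <= s.
  by apply: le_trans trace_state_le; rewrite fro_sqr SZ mxtrace_mulC.
have B_ge0 := spectral_norm_ge0 B; have C_ge0 := spectral_norm_ge0 C.
have R_ge0 := spectral_norm_ge0 R; have z0 := zeta_ge0; have a0 := trace_bound_ge0.
have dir (D : 'M[F]_(m, d)) : frobenius_norm D <= 1 ->
    frobenius_norm (D *m C *m Z) <= nC * f.
  move=> D1; rewrite -mulmxA; apply: le_trans (fro_mulmx _ _) _.
  rewrite -[leRHS]mul1r; apply: ler_pM; rewrite ?fro_ge0//.
  exact: spectral_norm_fro.
have Bdir (D : 'M[F]_(m, d)) : frobenius_norm D <= 1 ->
    frobenius_norm (B *m D *m C *m Z) <= nB * (nC * f).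
  move=> D1; rewrite -!mulmxA; apply: le_trans (spectral_norm_fro _ _) _.
  by rewrite ler_wpM2l// mulmxA dir.
have AZ : frobenius_norm (Acl *m Z) <= f.
  rewrite -(@ler_pXn2r _ 2)// ?nnegrE ?fro_ge0// !fro_sqr.
  rewrite mxtrace_mulC trmx_mul mulmxA -[Acl *m Z *m Z^T]mulmxA -SZ.
  rewrite [leRHS]mxtrace_mulC -SZ {2}state_mxE// mxtraceD lerDr.
  by have := psdmx_tr 1%:M psdX0; rewrite trmx1 mul1mx mulmx1.
have split_tr p (X Y : 'M[F]_(p, n.+1)) (M : 'M[F]_p) :
    \tr (X^T *m M *m Y *m Sigma) = \tr ((X *m Z)^T *m (M *m (Y *m Z))).
  by rewrite SZ mulmxA mxtrace_mulC trmx_mul !mulmxA.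
have bound p (X Y : 'M[F]_(p, r)) (x y : F) :
    frobenius_norm X <= x -> frobenius_norm Y <= y -> `|\tr (X^T *m Y)| <= x * y.
  move=> Xx Yy; apply: le_trans (mxtr_CauchySchwarz _ _) _.
  by apply: ler_pM; rewrite ?fro_ge0.
have T1 : `|\tr ((G *m C)^T *m R *m (E *m C) *m Sigma)| <=
    (nC * f) * (nR * (nC * f)).
  rewrite split_tr; apply: bound; first exact: dir.
  apply: le_trans (spectral_norm_fro _ _) _.
  by rewrite ler_wpM2l// dir.
have T2 : `|\tr ((B *m G *m C)^T *m P *m (B *m E *m C) *m Sigma)| <=
    (nB * (nC * f)) * (a * (nB * (nC * f))).
  rewrite split_tr; apply: bound; first exact: Bdir.
  apply: (le_trans (value_mx_norm_le (B *m E *m C *m Z))).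
  exact: (ler_wpM2l a0 (Bdir _ E1)).
have T3 (D D' : 'M[F]_(m, d)) : frobenius_norm D <= 1 -> frobenius_norm D' <= 1 ->
    `|\tr ((B *m D *m C)^T *m W D' *m Acl *m Sigma)| <=
    (nB * (nC * f)) * (zeta * a * f).
  move=> D1 D1'; rewrite split_tr; apply: bound; first exact: Bdir.
  by apply: le_trans (value_diff_norm_le _ D1') _; exact: (ler_wpM2l (mulr_ge0 z0 a0) AZ).
rewrite cost_hessian_pair//.
exact: (hessian_estimate (spectral_norm_gt0 B0) C_ge0 R_ge0 a0 z0 f2 T1 T2
  (T3 _ _ G1 E1) (T3 _ _ E1 G1)).
Qed.

Lemma state_diffZ (e : F) (E : 'M[F]_(m, d)) :
  state_diff A B C X0 K (e *: E) = e *: state_diff A B C X0 K E.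
Proof.
have gen (Y M : 'M[F]_n.+1) :
    - (B *m (e *: E) *m C *m Y *m M^T + M *m Y *m (B *m (e *: E) *m C)^T) =
    e *: - (B *m E *m C *m Y *m M^T + M *m Y *m (B *m E *m C)^T).
  by rewrite -!scalemxAr -!scalemxAl trmxZ -scalemxAr -scalerDr scalerN.
by rewrite /state_diff gen lyapZ.
Qed.

Lemma cost_hessianZ (e : F) (E : 'M[F]_(m, d)) :
  cost_hessian A B C Q R X0 K (e *: E) = e *: cost_hessian A B C Q R X0 K E.
Proof.
have gen (Y Y' M N W' : 'M[F]_n.+1) (G : 'M[F]_(m, n.+1)) :
    2 *: ((R *m (e *: E) *m C + B^T *m Y *m (B *m (e *: E) *m C)
      - B^T *m (e *: W') *m M) *m N *m C^T + G *m (e *: Y') *m C^T) =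
    e *: (2 *: ((R *m E *m C + B^T *m Y *m (B *m E *m C)
      - B^T *m W' *m M) *m N *m C^T + G *m Y' *m C^T)).
  rewrite -!scalemxAr -!scalemxAl -!scalemxAr -scalerDr -scalerBr -!scalemxAl.
  by rewrite -scalerDr !scalerA mulrC.
by rewrite /cost_hessian {1}/value_diff value_sourceZ lyapZ state_diffZ gen.
Qed.

Lemma cost_hessian_quadratic_le (E : 'M[F]_(m, d)) : B != 0 ->
  \tr (E^T *m cost_hessian A B C Q R X0 K E) <= smoothness_constant * frobenius_norm E ^+ 2.
Proof.
move=> B0; have [->|E0] := eqVneq E 0.
  by rewrite trmx0 mul0mx mxtrace0 fro0 expr0n mulr0.
have e0 := fro_gt0 E0; set e := frobenius_norm E in e0 *.
have E1 : frobenius_norm (e^-1 *: E) <= 1.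
  by rewrite froZ ger0_norm ?invr_ge0 ?(ltW e0)// mulVf// gt_eqF.
have := le_trans (ler_norm _) (cost_hessian_le B0 E1 E1).
rewrite cost_hessianZ trmxZ -scalemxAl -scalemxAr !mxtraceZ mulrA -expr2 exprVn.
by rewrite ler_pdivrMl ?exprn_gt0// mulrC.
Qed.

End HessianBound.

(** * Vectorization *)

Section Vectorization.
Variables (F : realType) (m d : nat).

Lemma unvecK (v : 'cV[F]_(d * m)) : vec (@unvec F m d v) = v.
Proof. by rewrite /vec /unvec trmxK vec_mxK trmxK. Qed.

Lemma mxtr_vec (X Y : 'M[F]_(m, d)) : \tr ((vec X)^T *m vec Y) = \tr (X^T *m Y).
Proof.
rewrite !mxtr_mulT [RHS]exchange_big /= (pair_big xpredT xpredT (fun j i => X i j * Y i j)).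
rewrite (reindex _ (curry_mxvec_bij _ _)) /=.
apply: eq_bigr => -[j i] _ /=; rewrite big_ord1 !mxE.
by rewrite !mxvecE !mxE.
Qed.

Lemma fro_vec (X : 'M[F]_(m, d)) : frobenius_norm (vec X) = frobenius_norm X.
Proof.
apply/eqP; rewrite -(@eqrXn2 _ 2)// ?fro_ge0// !fro_sqr; apply/eqP.
exact: mxtr_vec.
Qed.

Lemma mxtr_mulT_delta p q (X : 'M[F]_(p, q)) i j : \tr (X^T *m delta_mx i j) = X i j.
Proof.
rewrite mxtr_mulT (bigD1 i)//= (bigD1 j)//= mxE !eqxx mulr1 big1 ?addr0.
  rewrite big1 ?addr0// => k ki; apply: big1 => l _.
  by rewrite mxE (negbTE ki) mulr0.
by move=> l lj; rewrite mxE (negbTE lj) andbF mulr0.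
Qed.

Variables (V : normedModType F) (v h : V).

Lemma has_diff_vec (f : V -> 'M[F]_(m, d)) df :
  has_diff f v h df -> has_diff (fun w => vec (f w)) v h (vec df).
Proof.
by move=> hf; exact: (has_diff_trmx (has_diff_linmx (@mxvec F d m) (has_diff_trmx hf))).
Qed.

Lemma has_diff_unvec (f : V -> 'cV[F]_(d * m)) df :
  has_diff f v h df -> has_diff (fun w => @unvec F m d (f w)) v h (unvec df).
Proof.
by move=> hf; exact: (has_diff_trmx (has_diff_linmx (@vec_mx F d m) (has_diff_trmx hf))).
Qed.

End Vectorization.

Section GradientHessian.
Variable F : realType.

Lemma gradient_eq p q (f : 'M[F]_(p, q) -> F) (M G : 'M[F]_(p, q)) :
  (forall E, has_diff f M E (\tr (G^T *m E))) -> gradient f M = G.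
Proof.
move=> h; apply/matrixP => i j; rewrite mxE.
by have [_ ->] := h (delta_mx i j); rewrite mxtr_mulT_delta.
Qed.

(** For a differentiable gradient the Hessian matrix represents its differential. *)
Lemma hessian_mulmx p (f : 'cV[F]_p -> F) (v x y : 'cV[F]_p) :
  has_diff (gradient f) v x y -> hessian f v *m x = y.
Proof.
move=> hg; have [dg _] := hg; apply/matrixP => i j; rewrite (ord1 j) {j} mxE.
have /has_diff_mxE/(_ i 0)[dgi <-] := hg.
rewrite (deriveE _ dgi) {2}(matrix_sum_delta x) linear_sum; apply: eq_bigr => k _.
by rewrite big_ord1 linearZ /= mxE deriveE// mulrC.
Qed.

Lemma is_derive_nonincr (f df : F -> F) (x : F) : 0 <= x ->
  (forall t, 0 <= t <= x -> has_diff (f : F^o -> F) t 1 (df t)) ->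
  (forall t, 0 <= t <= x -> df t <= 0) -> f x <= f 0.
Proof.
move=> x0 hf hdf.
have [||c] := @MVT_segment F f df 0 x x0.
- move=> t; rewrite in_itv /= => /andP[t0 tx].
  have [|d1 <-] := hf t; first by rewrite !ltW.
  by apply: DeriveDef => //; exact: diff_derivable.
- apply: continuous_in_subspaceT => t; rewrite inE /= in_itv /= => tx.
  by have [d1 _] := hf t tx; exact: differentiable_continuous.
rewrite in_itv /= => cx; rewrite subr0 => fx.
rewrite -subr_le0 fx mulr_le0_ge0//; exact: hdf.
Qed.

(** Twice the mean value theorem: first for f1 - lam t, then for
    f - f1(0) t - lam t^2 / 2. *)
Lemma second_order_upper_bound (f f1 f2 : F^o -> F) (lam : F) :
  (forall t, 0 <= t <= 1 -> has_diff f t 1 (f1 t)) ->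
  (forall t, 0 <= t <= 1 -> has_diff f1 t 1 (f2 t)) ->
  (forall t, 0 <= t <= 1 -> f2 t <= lam) ->
  f 1 <= f 0 + f1 0 + lam / 2.
Proof.
move=> hf hf1 hf2.
have hid (t : F^o) : has_diff (fun u : F^o => u : F) t 1 (1 : F) := has_diff_id t 1.
have f1_le t : 0 <= t <= 1 -> f1 t <= f1 0 + lam * t.
  move=> /andP[t0 t1].
  suff : f1 t - lam * t <= f1 0 - lam * 0 by lra.
  apply: (@is_derive_nonincr (fun u => f1 u - lam * u) (fun u => f2 u - lam)) => // u.
    move=> /andP[u0 ut].
    apply: (has_diff_eq (has_diffB (hf1 u _)
      (has_diffM (has_diff_cst _ _ lam) (hid u)))); last by lra.
    by rewrite u0 (le_trans ut).
  by move=> /andP[u0 ut]; rewrite subr_le0 hf2// u0 (le_trans ut).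
suff : f 1 - f1 0 * 1 - lam / 2 * (1 * 1) <= f 0 - f1 0 * 0 - lam / 2 * (0 * 0) by lra.
apply: (@is_derive_nonincr (fun u => f u - f1 0 * u - lam / 2 * (u * u))
  (fun u => f1 u - f1 0 - lam * u)) => // u u01; last by have := f1_le u u01; lra.
apply: (has_diff_eq (has_diffB (has_diffB (hf u u01)
  (has_diffM (has_diff_cst _ _ (f1 0)) (hid u)))
  (has_diffM (has_diff_cst _ _ (lam / 2)) (has_diffM (hid u) (hid u))))).
lra.
Qed.

End GradientHessian.

(** * Smoothness of the cost *)

Section CostSmoothness.
Variables (F : realType) (n m d : nat).
Variables (A : 'M[F]_n.+1) (B : 'M[F]_(n.+1, m)) (C : 'M[F]_(d, n.+1)).
Variables (Q : 'M[F]_n.+1) (R : 'M[F]_m).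
Variables (disp : measure_display) (T : measurableType disp).
Variables (P : probability T F) (x0 : T -> 'cV[F]_n.+1).
Hypotheses (posQ : posdefmx Q) (posR : posdefmx R).
Hypothesis x0_moments : finite_second_moments P x0.
Hypothesis mu_gt0 : 0 < sigma_min (second_moment P x0).
Hypothesis B_neq0 : B != 0.
Variable alpha : F.

Local Notation X0 := (second_moment P x0).
Local Notation J := (cost A B C P x0 Q R).
Local Notation Kalpha := (sublevel A B C P x0 Q R alpha).
Local Notation stable K := (power_vanishing (closed_loop A B C K)).
Local Notation grad K := (cost_gradient A B C Q R X0 K).
Local Notation hess K := (cost_hessian A B C Q R X0 K).
Local Notation L := (smoothness_constant B C Q R X0 alpha).

Let symQ := posdef_sym posQ.
Let symR := posdef_sym posR.
Let symX0 := second_moment_sym P x0.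

Lemma sublevel_stable K : Kalpha K -> stable K.
Proof. by move=> [fK _]; exact: spectral_radius_power_vanishing. Qed.

Lemma sublevel_trace K : Kalpha K -> \tr (value_mx A B C Q R K *m X0) <= alpha.
Proof.
move=> hK; have := sublevel_stable hK; case: hK => _ JK sK.
by move: JK; rewrite (cost_trace x0_moments).
Qed.

Lemma stable_near (V : normedModType F) (kappa : V -> 'M[F]_(m, d)) (v : V) :
  differentiable kappa v -> stable (kappa v) -> \forall w \near v, stable (kappa w).
Proof.
move=> dk; apply: (@power_vanishing_near _ _ _ (fun w => closed_loop A B C (kappa w))).
by have [] := has_diff_closed_loop A B C (differentiable_has_diff 0 dk).
Qed.

(** The closed formula of the cost holds on a neighbourhood, since stability is
    an open condition. *)
Lemma has_diff_cost (V : normedModType F) (kappa : V -> 'M[F]_(m, d)) (v h : V) E :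
  has_diff kappa v h E -> stable (kappa v) ->
  has_diff (fun w => J (kappa w)) v h (\tr ((grad (kappa v))^T *m E)).
Proof.
move=> hk sk; apply: has_diff_near_eq (has_diff_trace_cost symQ symR symX0 hk sk).
have [dk _] := hk; apply: filterS (stable_near dk sk) => w sw.
by rewrite (cost_trace x0_moments).
Qed.

Lemma gradient_cost K : stable K -> gradient J K = grad K.
Proof.
by move=> sK; apply: gradient_eq => E; exact: has_diff_cost (has_diff_id K E) sK.
Qed.

Let Jvec (v : 'cV[F]_(d * m)) : F := J (unvec v).

Lemma gradient_cost_vec (v : 'cV[F]_(d * m)) : stable (unvec v) ->
  gradient Jvec v = vec (grad (unvec v)).
Proof.
move=> sv; apply: gradient_eq => E.
apply: (has_diff_eq (has_diff_cost (has_diff_unvec (has_diff_id v E)) sv)).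
by rewrite -mxtr_vec unvecK.
Qed.

Lemma has_diff_gradient_vec (v h : 'cV[F]_(d * m)) : stable (unvec v) ->
  has_diff (gradient Jvec) v h (vec (hess (unvec v) (unvec h))).
Proof.
move=> sv; have hu : has_diff (fun w => @unvec F m d w) v h (unvec h).
  exact: has_diff_unvec (has_diff_id v h).
apply: (has_diff_near_eq _
  (has_diff_vec (has_diff_cost_gradient X0 symQ symR hu sv))).
have [du _] := hu; apply: filterS (stable_near du sv) => w sw.
exact/esym/gradient_cost_vec.
Qed.

Lemma cost_vec_twice_differentiable (v : 'cV[F]_(d * m)) : stable (unvec v) ->
  twice_differentiable Jvec v.
Proof.
move=> sv; split; last by have [] := has_diff_gradient_vec 0 sv.
have [du _] : has_diff (fun w => @unvec F m d w) v 0 (unvec 0).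
  exact: has_diff_unvec (has_diff_id v 0).
apply: filterS (stable_near du sv) => w sw.
by have [] := has_diff_cost (has_diff_unvec (has_diff_id w 0)) sw.
Qed.

(** The norm of the image H of a vector is the value of the bilinear form on
    that vector and on H normalized. *)
Lemma hessian_cost_le K : Kalpha K -> spectral_norm (hessian Jvec (vec K)) <= L.
Proof.
move=> hK; have sK := sublevel_stable hK; have tK := sublevel_trace hK.
have bound := cost_hessian_le posQ posR symX0 (second_moment_psd x0_moments)
  mu_gt0 sK tK B_neq0.
apply: spectral_norm_le => x x1.
have sv : stable (unvec (vec K)) by rewrite vecK.
rewrite (hessian_mulmx (has_diff_gradient_vec x sv)) vecK.
have x1' : frobenius_norm (@unvec F m d x) <= 1 by rewrite -fro_vec unvecK.
set H := hess K (unvec x); rewrite fro_vec.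
have [H0|H0] := eqVneq H 0.
  rewrite H0 fro0.
  by apply: le_trans (bound (unvec x) (unvec x) x1' x1'); exact: normr_ge0.
have h0 := fro_gt0 H0; set e := frobenius_norm H in h0 *.
have G1 : frobenius_norm (e^-1 *: H) <= 1.
  by rewrite froZ ger0_norm ?invr_ge0 ?(ltW h0)// mulVf// gt_eqF.
apply: le_trans (bound _ _ x1' G1); apply: le_trans (ler_norm _).
rewrite trmxZ -scalemxAl mxtraceZ -/H -fro_sqr -/e expr2 mulKf//.
by rewrite gt_eqF.
Qed.

(** Along the segment the second derivative of the cost is the Hessian form,
    which the sublevel set bounds at every point. *)
Lemma cost_descent K K' :
  (forall t : F, 0 <= t <= 1 -> Kalpha (K + t *: (K' - K))) ->
  J K' <= J K + \tr ((gradient J K)^T *m (K' - K))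
          + L / 2 * frobenius_norm (K' - K) ^+ 2.
Proof.
move=> seg; set E := K' - K.
pose kappa (t : F^o) : 'M[F]_(m, d) := K + t *: E.
have hk (t : F) : has_diff kappa t 1 E.
  apply: (has_diff_eq (has_diffD (has_diff_cst _ _ K) (has_diffZl E (has_diff_id (t : F^o) 1)))).
  by rewrite add0r scale1r.
have sk (t : F) : 0 <= t <= 1 -> stable (kappa t).
  by move=> t01; exact: sublevel_stable (seg t t01).
have k0 : kappa 0 = K by rewrite /kappa scale0r addr0.
have k1 : kappa 1 = K' by rewrite /kappa scale1r addrC subrK.
have sK : stable K by rewrite -k0; apply: sk; rewrite lexx ler01.
rewrite (gradient_cost sK).
have := @second_order_upper_bound F (fun t => J (kappa t))
  (fun t => \tr ((grad (kappa t))^T *m E)) (fun t => \tr ((hess (kappa t) E)^T *m E))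
  (L * frobenius_norm E ^+ 2).
rewrite k0 k1 => h; rewrite mulrAC; apply: h => t t01.
- exact: has_diff_cost (hk t) (sk t t01).
- have hg := has_diff_cost_gradient X0 symQ symR (hk t) (sk t t01).
  apply: (has_diff_eq
    (has_diff_trace (has_diff_mulmx (has_diff_trmx hg) (has_diff_cst _ _ E)))).
  by rewrite mulmx0 addr0.
rewrite mxtr_mulT_sym; have ht := seg t t01.
exact: (cost_hessian_quadratic_le posQ posR symX0 (second_moment_psd x0_moments)
  mu_gt0 (sublevel_stable ht) (sublevel_trace ht) E B_neq0).
Qed.

End CostSmoothness.

Theorem lemma5 (F : realType) (n m d : nat)
  (A : 'M[F]_n) (B : 'M[F]_(n, m)) (C : 'M[F]_(d, n))
  (Q : 'M[F]_n) (R : 'M[F]_m)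
  (disp : measure_display) (T : measurableType disp)
  (P : probability T F) (x0 : T -> 'cV[F]_n)
  (Kstar : 'M[F]_(m, d)) (alpha : F)
  (C_full_row_rank : row_free C)
  (Q_posdef : posdefmx Q) (R_posdef : posdefmx R)
  (x0_random : random_vector x0)
  (x0_moments : finite_second_moments P x0)
  (mu_gt0 : 0 < sigma_min (second_moment P x0))
  (B_neq0 : B != 0)
  (Kstar_min : cost_minimizer A B C P x0 Q R Kstar)
  (alpha_ge : cost A B C P x0 Q R Kstar <= alpha) :
  let J := cost A B C P x0 Q R in
  let Kalpha := sublevel A B C P x0 Q R alpha in
  let mu := sigma_min (second_moment P x0) in
  let nB := spectral_norm B in
  let nC := spectral_norm C in
  let nR := spectral_norm R in
  let zeta1 := 1 / sigma_min Q
                 * ((1 + nC ^+ 2 * nB ^+ 2) * (alpha / mu) + nC ^+ 2 * nR) - 1 in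
  let L := 2 * nC ^+ 2
             * (nR + nB ^+ 2 * (1 + 2 * zeta1 / (nC * nB)) * (alpha / mu))
             * (alpha / sigma_min Q) in
  let Jvec := fun v : 'cV[F]_(d * m) => J (unvec v) in
  (forall K, Kalpha K ->
     twice_differentiable Jvec (vec K) /\
     spectral_norm (hessian Jvec (vec K)) <= L) /\
  (forall K K', Kalpha K -> Kalpha K' ->
     (forall delta : F, 0 <= delta <= 1 -> Kalpha (K + delta *: (K' - K))) ->
     J K' <= J K + \tr ((gradient J K)^T *m (K' - K))
             + L / 2 * frobenius_norm (K' - K) ^+ 2).
Proof.
case: n A B C Q x0 C_full_row_rank Q_posdef x0_random x0_moments mu_gt0 B_neq0
  Kstar_min alpha_ge => [|n'] A' B' C' Q' x0' _ posQ _ hmom mu0 B0 _ _.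
  by move/negP: B0; case; rewrite (flatmx0 B').
move=> J Kalpha mu nB nC nR zeta1 L Jvec; split=> [K hK|K K' _ _ seg].
  split; last exact: hessian_cost_le.
  by apply: cost_vec_twice_differentiable; rewrite // vecK; exact: sublevel_stable hK.
exact: (cost_descent posQ R_posdef hmom mu0 B0 seg).
Qed.
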